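(* For any two simple graphs $G$ and $H$ and every integer $t \geq 1$, the following implications hold: \[ G \simeq_{3t}^{\mathrm{SA}} H \implies G \simeq_t^{\mathrm{L}} H \implies G \simeq_t^{\mathrm{SA}} H . \] Furthermore, for every $t \geq 1$, there exist simple graphs $G$ and $H$ such that $G \simeq_{3t-1}^{\mathrm{SA}} H$ and $G \not\simeq_t^{\mathrm{L}} H$.
   Context: Graphs are finite and undirected; simple means without loops and multiple edges. For a set $X$ and $k \in \mathbb{N}$, $\binom{X}{\leq k}$ is the set of subsets of $X$ of size at most $k$. An element $(g,h) \in V(G)\times V(H)$ is written $gh$. A set $\{g_1h_1,\dots,g_\ell h_\ell\} \subseteq V(G)\times V(H)$ is a partial isomorphism if for all $i,j\in[\ell]$: $g_i=g_j \Leftrightarrow h_i=h_j$, and $g_ig_j\in E(G) \Leftrightarrow h_ih_j \in E(H)$. (The empty set is a partial isomorphism.) Lasserre relaxation: $G \simeq_t^{\mathrm{L}} H$ means that the following system (the level-$t$ Lasserre relaxation for graph isomorphism) in real variables $y_I$, $I \in \binom{V(G)\times V(H)}{\leq 2t}$, is feasible: (i) the matrix $(y_{I\cup J})_{I,J\in\binom{V(G)\times V(H)}{\leq t}}$ is positive semidefinite; (ii) $\sum_{h\in V(H)} y_{I\cup\{gh\}} = y_I$ for all $I \in \binom{V(G)\times V(H)}{\leq 2t-2}$ and $g\in V(G)$; (iii) $\sum_{g\in V(G)} y_{I\cup\{gh\}} = y_I$ for all $I \in \binom{V(G)\times V(H)}{\leq 2t-2}$ and $h\in V(H)$; (iv)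 $y_I=0$ for every $I\in\binom{V(G)\times V(H)}{\leq 2t}$ that is not a partial isomorphism; (v) $y_\emptyset=1$. Sherali--Adams relaxation: $G \simeq_t^{\mathrm{SA}} H$ means that the level-$t$ Sherali--Adams relaxation of the integer quadratic program for graph isomorphism has a non-negative rational solution, i.e. there are non-negative rationals $y_I$, $I\in\binom{V(G)\times V(H)}{\leq t}$, with $y_\emptyset=1$; $y_I=0$ whenever $I$ is not a partial isomorphism; and for all $I\in\binom{V(G)\times V(H)}{\leq t-1}$, $\sum_{h\in V(H)} y_{I\cup\{gh\}} = y_I$ for all $g\in V(G)$ and $\sum_{g\in V(G)} y_{I\cup\{gh\}} = y_I$ for all $h\in V(H)$. It is known, and recalled in the paper, that $G \simeq_t^{\mathrm{SA}} H$ holds if and only if $\hom(F,G)=\hom(F,H)$ for every graph $F$ of treewidth at most $t-1$, where $\hom(F,G)$ is the number of graph homomorphisms from $F$ to $G$. *)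

(* Defs.v *)
From mathcomp Require Import all_boot all_order all_algebra.
From mathcomp Require Import reals.

Set Implicit Arguments.
Unset Strict Implicit.
Unset Printing Implicit Defensive.

Import Order.TTheory GRing.Theory Num.Theory.
Local Open Scope ring_scope.

Record sgraph := SGraph {
  vertex :> finType;
  edge : rel vertex;
  edge_sym : symmetric edge;
  edge_irr : irreflexive edge }.

Definition subsets_le (T : finType) (k : nat) : {set {set T}} :=
  [set I : {set T} | (#|I| <= k)%N].

Definition partial_iso (G H : sgraph) (I : {set G * H}) : bool :=
  [forall p in I, forall q in I,
     ((p.1 == q.1) == (p.2 == q.2)) && (edge p.1 q.1 == edge p.2 q.2)].

Definition psdmx (R : realType) (n : nat) (M : 'M[R]_n) : Prop :=
  M^T = M /\ forall x : 'cV[R]_n, 0 <= (x^T *m M *m x) 0 0.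

(* Rows and columns are indexed by the sets of size at most t, through the
   enumeration enum_val of the finite set subsets_le T t. *)
Definition moment_mx (R : realType) (T : finType) (t : nat) (y : {set T} -> R) :
    'M[R]_#|subsets_le T t| :=
  \matrix_(i, j) y (enum_val i :|: enum_val j).

(* In both relaxations y is a total function on {set G * H}, but only its values
   on sets of size at most 2t (resp. t) are constrained; the remaining values
   are irrelevant.  The subtractions on nat do not truncate for t >= 1. *)
Definition lasserre (R : realType) (t : nat) (G H : sgraph) : Prop :=
  exists y : {set G * H} -> R,
    [/\ psdmx (moment_mx t y),
        forall I, I \in subsets_le (G * H)%type (2 * t - 2) ->
          forall g : G, \sum_(h : H) y ((g, h) |: I) = y I,
        forall I, I \in subsets_le (G * H)%type (2 * t - 2) ->
          forall h : H, \sum_(g : G) y ((g, h) |: I) = y I,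
        forall I, I \in subsets_le (G * H)%type (2 * t) ->
          ~~ partial_iso I -> y I = 0
      & y set0 = 1].

Definition sherali_adams (t : nat) (G H : sgraph) : Prop :=
  exists y : {set G * H} -> rat,
    [/\ forall I, I \in subsets_le (G * H)%type t -> 0 <= y I,
        y set0 = 1,
        forall I, I \in subsets_le (G * H)%type t ->
          ~~ partial_iso I -> y I = 0,
        forall I, I \in subsets_le (G * H)%type (t - 1) ->
          forall g : G, \sum_(h : H) y ((g, h) |: I) = y I
      & forall I, I \in subsets_le (G * H)%type (t - 1) ->
          forall h : H, \sum_(g : G) y ((g, h) |: I) = y I].

(* Main.v *)
(* Padding both vertex sets by a dummy vertex, tuples [x] over [G] and [z] over [H]
   encode partial maps, and a Sherali-Adams solution [y] of level [3t] weighs pairs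
   [(x, z)].  The components of the bipartite graph [{(x, z) | y(x, z) > 0}] on
   [2t]-tuples color [V(G)^t * V(G)^t] and [V(H)^t * V(H)^t]; since [y] extends to
   [3t]-tuples, double counting shows that these colorings are coherent
   configurations with the same intersection numbers.  The Lasserre solution is
   [[col x = col z] / N(col x)] with [N] the color sizes.  Its moment matrix [M] is
   positive semidefinite because [M^2 = Z M] for the positive definite Casimir
   element [Z] of the configuration.

   Conversely the diagonal of the moment matrix is nonnegative, and a real
   nonnegative solution of a rational homogeneous system can be made rational.

   For the separation take the untwisted and twisted Cai-Fuerer-Immerman graphs of
   the complete graph on [n = 3t] vertices.  Uniformly random consistent local
   shifts form a Sherali-Adams solution of level [n - 1].  Only the untwisted graph
   contains an [n]-clique, while Lasserre solutions of level [t] preserve the number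
   of [3t]-cliques: if [A] is the matrix of [2t]-cliques indexed by [t]-tuples, the
   moment matrix, read as a completely positive map, is multiplicative on [A], so
   that it preserves [tr A^3]. *)
Require Import Defs.
From mathcomp Require Import all_boot all_order all_algebra.
From mathcomp Require Import reals.
From mathcomp Require Import ring lra zify.

Set Implicit Arguments.
Unset Strict Implicit.
Unset Printing Implicit Defensive.

Import Order.TTheory GRing.Theory Num.Theory.
Local Open Scope ring_scope.

(** * Positive semidefinite kernels *)

Section PsdKernel.
Variable F : realFieldType.

Definition psd_kernel (K : finType) (M : K -> K -> F) :=
  forall w : K -> F, 0 <= \sum_k \sum_l w k * M k l * w l.

(** A weight on [L] is pushed forward to [K] by summing over the fibers of [s], so repeated indices
    are allowed. *)
Lemma psd_kernel_pullback (K L : finType) (M : K -> K -> F) (s : L -> K) :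
  psd_kernel M -> psd_kernel (fun i j => M (s i) (s j)).
Proof.
move=> psdM w; have := psdM (fun k => \sum_(i | s i == k) w i).
congr (0 <= _); rewrite [RHS](partition_big s predT) //=; apply: eq_bigr => k _.
under [RHS]eq_bigr => i /eqP si do rewrite (partition_big s predT) //=.
rewrite exchange_big /=; apply: eq_bigr => l _.
rewrite -mulrA mulr_suml; apply: eq_bigr => i /eqP ->.
by rewrite mulrA mulr_sumr; apply: eq_bigr => j /eqP ->.
Qed.

Lemma psd_kernel_diag (K : finType) (M : K -> K -> F) k :
  psd_kernel M -> 0 <= M k k.
Proof.
move=> /(_ (fun l => (l == k)%:R)); rewrite (bigD1 k) //= [X in _ + X]big1.
  rewrite (bigD1 k) //= big1 ?eqxx ?mul1r ?mulr1 ?addr0 // => l /negPf->.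
  by rewrite mulr0.
by move=> l /negPf->; rewrite big1 // => *; rewrite !mul0r.
Qed.

(** An isotropic vector of a semidefinite form lies in its radical: moving [w] by [c] along the
    basis vector at [k] changes the form to [2 c b + c^2 M k k], which would be negative for some
    [c] if [b] were nonzero. *)
Lemma psd_kernel_isotropic (K : finType) (M : K -> K -> F) (w : K -> F) k :
  (forall i j, M i j = M j i) -> psd_kernel M ->
  \sum_i \sum_j w i * M i j * w j = 0 -> \sum_j M k j * w j = 0.
Proof.
move=> symM psdM w0; set b := (LHS).
have a0 : 0 <= M k k by apply: psd_kernel_diag.
have q c : 0 <= 2 * c * b + c ^+ 2 * M k k.
  have := psdM (fun i => w i + c * (i == k)%:R).
  congr (0 <= _); pose e i : F := c * (i == k)%:R.
  have sume f : \sum_i e i * f i = c * f k.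
    rewrite (bigD1 k) //= big1 ?addr0 ?/e ?eqxx ?mulr1 // => i /negPf->.
    by rewrite mulr0 mul0r.
  transitivity (\sum_i \sum_j w i * M i j * w j
     + \sum_i \sum_j w i * M i j * e j + \sum_i e i * (\sum_j M i j * w j)
     + \sum_i e i * (\sum_j e j * M i j)).
    rewrite -!big_split /=; apply: eq_bigr => i _.
    rewrite !mulr_sumr -!big_split /=; apply: eq_bigr => j _.
    by rewrite -/(e i) -/(e j); move: (e i) (e j) => ei ej; ring.
  have -> : \sum_i \sum_j w i * M i j * e j = \sum_i e i * (\sum_j M i j * w j).
    rewrite exchange_big; apply: eq_bigr => j _; rewrite mulr_sumr.
    by apply: eq_bigr => i _; rewrite (symM j i); move: (e j) => ej; ring.
  by rewrite w0 !sume /b; ring.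
have a1 : 0 < M k k + 1 by lra.
(* Adding 1 to [M k k] in the minimizing [c] avoids a division by zero when [M k k = 0]. *)
have := q (- b / (M k k + 1)).
rewrite (_ : _ + _ = - ((b / (M k k + 1)) ^+ 2 * (M k k + 2))); last first.
  by field; lra.
rewrite oppr_ge0 pmulr_lle0; last by lra.
move=> le0; have /eqP : (b / (M k k + 1)) ^+ 2 = 0.
  by apply/eqP; rewrite eq_le le0 sqr_ge0.
rewrite sqrf_eq0 mulf_eq0 invr_eq0 => /orP[/eqP//|/eqP]; lra.
Qed.

(* [M] and [Z] commute since [M *m M] is symmetric; writing [x = Z u] then gives
   [x^T M x = (M u)^T Z (M u)]. *)
Lemma psd_of_square (n : nat) (M Z : 'M[F]_n) :
  M^T = M -> Z^T = Z ->
  (forall u : 'cV_n, 0 <= (u^T *m Z *m u) 0 0) ->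
  (forall u : 'cV_n, (u^T *m Z *m u) 0 0 = 0 -> u = 0) ->
  M *m M = Z *m M ->
  forall x : 'cV_n, 0 <= (x^T *m M *m x) 0 0.
Proof.
move=> symM symZ Zge0 Zpos MM x.
have Zunit : Z \in unitmx.
  rewrite -row_free_unit -kermx_eq0; apply/rowV0P => v /sub_kermxP vZ.
  apply: trmx_inj; rewrite trmx0; apply: Zpos.
  by rewrite trmxK vZ mul0mx mxE.
have MZ : M *m Z = Z *m M by rewrite -{1}symM -{1}symZ -trmx_mul -MM trmx_mul symM.
have [u ->] : exists u, x = Z *m u by exists (invmx Z *m x); rewrite mulKVmx.
suff -> : (Z *m u)^T *m M *m (Z *m u) = (M *m u)^T *m Z *m (M *m u) by exact: Zge0.
rewrite trmx_mul symZ trmx_mul symM -!mulmxA; congr (_ *m _).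
by rewrite (mulmxA Z M) -MM -mulmxA (mulmxA M Z) MZ -mulmxA.
Qed.

End PsdKernel.

Lemma moment_psd_kernel (R : realType) (T : finType) t (y : {set T} -> R)
    (K : finType) (s : K -> {set T}) :
  psdmx (moment_mx t y) -> (forall k, #|s k| <= t)%N ->
  psd_kernel (fun k l => y (s k :|: s l)).
Proof.
move=> [_ psdy] les.
have s_in k : s k \in subsets_le T t by rewrite inE.
have in0 : set0 \in subsets_le T t by rewrite inE cards0.
have psdI : psd_kernel (fun i j : 'I_#|subsets_le T t| =>
    y (enum_val i :|: enum_val j)).
  move=> w; have := psdy (\col_i w i); rewrite -mulmxA mxE.
  congr (0 <= _); apply: eq_bigr => i _; rewrite !mxE mulr_sumr.
  by apply: eq_bigr => j _; rewrite !mxE mulrA.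
move=> w; have := psd_kernel_pullback (fun k => enum_rank_in in0 (s k)) psdI w.
congr (0 <= _); apply: eq_bigr => i _; apply: eq_bigr => j _.
by rewrite !enum_rankK_in.
Qed.

Lemma psd_kernel_moment (R : realType) (T : finType) t (y : {set T} -> R)
    (K : finType) (M : K -> K -> R) (r : {set T} -> K) :
  psd_kernel M ->
  (forall I J : {set T}, (#|I| <= t)%N -> (#|J| <= t)%N ->
     M (r I) (r J) = y (I :|: J)) ->
  psdmx (moment_mx t y).
Proof.
move=> psdM My; split.
  by apply/matrixP => i j; rewrite !mxE setUC.
move=> x; have := psd_kernel_pullback (fun i => r (enum_val i)) psdM (x ^~ 0).
rewrite -mulmxA mxE; congr (0 <= _); apply: eq_bigr => i _.
rewrite !mxE mulr_sumr; apply: eq_bigr => j _; rewrite !mxE mulrA My //.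
  by have := enum_valP i; rewrite inE.
by have := enum_valP j; rewrite inE.
Qed.

(** * Coherent colorings *)

Lemma psd_kernel_of_square (F : realFieldType) (K : finType) (M Z : K -> K -> F) :
  (forall k l, M k l = M l k) -> (forall k l, Z k l = Z l k) ->
  psd_kernel Z ->
  (forall u, \sum_k \sum_l u k * Z k l * u l = 0 -> forall k, u k = 0) ->
  (forall k l, \sum_j M k j * M j l = \sum_j Z k j * M j l) ->
  psd_kernel M.
Proof.
move=> symM symZ psdZ Zpos MM w.
pose mx (N : K -> K -> F) : 'M[F]_#|K| := \matrix_(i, j) N (enum_val i) (enum_val j).
have quad N (u : 'cV_#|K|) :
    (u^T *m mx N *m u) 0 0 =
    \sum_k \sum_l u (enum_rank k) 0 * N k l * u (enum_rank l) 0.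
  rewrite -mulmxA mxE (reindex enum_rank) /=; last exact/onW_bij/enum_rank_bij.
  apply: eq_bigr => k _; rewrite !mxE mulr_sumr.
  rewrite (reindex enum_rank) /=; last exact/onW_bij/enum_rank_bij.
  by apply: eq_bigr => l _; rewrite !mxE !enum_rankK mulrA.
have mul N1 N2 : mx N1 *m mx N2 = mx (fun k l => \sum_j N1 k j * N2 j l).
  apply/matrixP => i j; rewrite !mxE (reindex enum_rank) /=.
    by apply: eq_bigr => k _; rewrite !mxE enum_rankK.
  exact/onW_bij/enum_rank_bij.
have := @psd_of_square F _ (mx M) (mx Z) _ _ _ _ _ (\col_i w (enum_val i)).
rewrite quad; under eq_bigr => k _ do under eq_bigr => l _ do
  rewrite !mxE !enum_rankK.
apply.
- by apply/matrixP => i j; rewrite !mxE symM.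
- by apply/matrixP => i j; rewrite !mxE symZ.
- by move=> u; rewrite quad psdZ.
- move=> u; rewrite quad => /Zpos u0; apply/colP => i.
  by rewrite mxE -[i]enum_valK u0.
- by rewrite !mul; apply/matrixP => i j; rewrite !mxE MM.
Qed.

Section Coherent.
Variables (F : realFieldType) (A B C : finType).
Variables (cA : A -> A -> C) (cB : B -> B -> C).

Definition color_count (T : finType) (c : T -> T -> C) (d : C) : nat :=
  (\sum_x \sum_y (c x y == d))%N.

(** The intersection numbers of a coherent configuration, with both legs of the wedge leaving the
    middle point [w]. *)
Definition wedge_count (T : finType) (c : T -> T -> C) (a b : C) (x y : T) : nat :=
  (\sum_w ((c w x, c w y) == (a, b)))%N.

Hypothesis trA : forall x y x' y', cA x y = cA x' y' -> cA y x = cA y' x'.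
Hypothesis trAB : forall x y z z', cA x y = cB z z' -> cA y x = cB z' z.
Hypothesis trBA : forall x y z z', cB z z' = cA x y -> cB z' z = cA y x.
Hypothesis wedgeA : forall x y x' y' a b, cA x y = cA x' y' ->
  wedge_count cA a b x y = wedge_count cA a b x' y'.
Hypothesis wedgeAB : forall x y z z' a b, cA x y = cB z z' ->
  wedge_count cA a b x y = wedge_count cB a b z z'.
Hypothesis diagA : forall x y y', cA x x = cA y y' -> y = y'.
Hypothesis colorsB : forall z z', exists x y, cA x y = cB z z'.

Local Notation N := (color_count cA).

Definition coherent_kernel (k l : A * B) : F :=
  (cA k.1 l.1 == cB k.2 l.2)%:R / (N (cA k.1 l.1))%:R.

Lemma color_count_gt0 x y : 0 < (N (cA x y))%:R :> F.
Proof.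
by rewrite ltr0n /color_count (bigD1 x) //= (bigD1 y) //= eqxx.
Qed.

Lemma color_count_tr x y : N (cA x y) = N (cA y x).
Proof.
rewrite /color_count exchange_big; apply: eq_bigr => u _; apply: eq_bigr => v _.
by congr nat_of_bool; apply/eqP/eqP; apply: trA.
Qed.

(* Both sides count the triples [(v, u, u')] with colors [cA w x] on [(v, u)],
   [cA w x'] on [(v, u')] and [cB z z'] on [(u, u')]. *)
Lemma triangle_count w x x' z z' :
  (wedge_count cB (cA w x) (cA w x') z z' * N (cB z z') =
   wedge_count cA (cA x w) (cB z z') w x' * N (cA w x'))%N.
Proof.
have [x0 [x0' c0]] := colorsB z z'.
rewrite -(wedgeAB _ _ c0) /color_count !big_distrr /=.
transitivity (\sum_u \sum_u' \sum_v [&& cA u u' == cB z z', cA v u == cA w x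
     & cA v u' == cA w x'])%N.
  apply: eq_bigr => u _; rewrite big_distrr; apply: eq_bigr => u' _ /=.
  have [e|_] := eqVneq (cA u u'); last by rewrite muln0 big1.
  rewrite muln1 (@wedgeA x0 x0' u u') ?c0 ?e //.
under eq_bigr => u _ do rewrite exchange_big.
rewrite exchange_big /=; apply: eq_bigr => v _; rewrite exchange_big.
rewrite big_distrr /=; apply: eq_bigr => u' _.
have [e|_] := eqVneq (cA v u').
  rewrite muln1 -(@wedgeA v u') //; apply: eq_bigr => u _.
  rewrite /= xpair_eqE andbT andbC; congr (nat_of_bool (_ && _)).
  by apply/eqP/eqP; apply: trA.
by rewrite muln0 big1 // => u _; rewrite !andbF.
Qed.

(** With [A_c] the 0-1 matrix of color [c], this is the sum over [c] of [A_c A_c^T / N(c)]. Colors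
    that do not occur contribute zero because both indicators vanish. *)
Definition casimir (x y : A) : F :=
  \sum_w \sum_c (cA x w == c)%:R * (cA y w == c)%:R / (N c)%:R.

Lemma casimir_quad (u : A -> F) :
  \sum_x \sum_y u x * casimir x y * u y =
  \sum_w \sum_c (\sum_x (cA x w == c)%:R * u x) ^+ 2 / (N c)%:R.
Proof.
transitivity (\sum_x \sum_y \sum_w \sum_c
    u x * ((cA x w == c)%:R * (cA y w == c)%:R / (N c)%:R) * u y).
  apply: eq_bigr => x _; apply: eq_bigr => y _.
  rewrite mulr_sumr mulr_suml; apply: eq_bigr => w _.
  by rewrite mulr_sumr mulr_suml.
under eq_bigr => x _ do rewrite exchange_big.
rewrite exchange_big; apply: eq_bigr => w _.
under eq_bigr => x _ do rewrite exchange_big.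
rewrite exchange_big; apply: eq_bigr => c _ /=.
rewrite expr2 mulr_suml mulr_suml; apply: eq_bigr => x _.
rewrite mulr_sumr mulr_suml; apply: eq_bigr => y _.
by move: (_ == c)%:R (_ == c)%:R (_^-1) => a b d; ring.
Qed.

(** [Z] is the Casimir element on [A] tensored with the identity on [B]. Its form is a sum of
    squares, and [triangle_count] gives [M^2 = Z M]. *)
Lemma coherent_kernel_psd : psd_kernel coherent_kernel.
Proof.
pose Z (k l : A * B) : F := (k.2 == l.2)%:R * casimir k.1 l.1.
have pairE (f : A * B -> F) : \sum_p f p = \sum_w \sum_v f (w, v).
  by rewrite pair_bigA; apply: eq_bigr => -[].
have Zquad u : \sum_k \sum_l u k * Z k l * u l =
    \sum_z \sum_x \sum_y u (x, z) * casimir x y * u (y, z).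
  rewrite pairE exchange_big; apply: eq_bigr => z _; apply: eq_bigr => x _ /=.
  rewrite pairE.
  apply: eq_bigr => y _; rewrite /= (bigD1 z) //= big1 ?addr0.
    by rewrite /Z /= eqxx mul1r.
  by move=> z' /negPf z'z; rewrite /Z /= eq_sym z'z mul0r mulr0 mul0r.
have term_ge0 v w c : 0 <= (\sum_x (cA x w == c)%:R * v x) ^+ 2 / (N c)%:R :> F.
  by rewrite mulr_ge0 ?sqr_ge0 // invr_ge0 ler0n.
have casimir_ge0 v : 0 <= \sum_x \sum_y v x * casimir x y * v y.
  by rewrite casimir_quad; do 2!apply: sumr_ge0 => ? _.
apply: (@psd_kernel_of_square _ _ _ Z).
- move=> [x z] [y w]; rewrite /coherent_kernel /= color_count_tr.
  by congr (_%:R / _); congr nat_of_bool; apply/eqP/eqP; apply: trAB.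
- move=> k l; rewrite /Z eq_sym; congr (_ * _); apply: eq_bigr => w _.
  by apply: eq_bigr => c _; rewrite [_%:R * _%:R]mulrC.
- by move=> u; rewrite Zquad; apply: sumr_ge0 => z _; apply: casimir_ge0.
- move=> u /eqP; rewrite Zquad psumr_eq0 // => /allP u0 [x z].
  (* Among the vanishing squares, the one at [w = x] and color [cA x x] has [u (x, z)] as its only
     term, since [diagA] excludes every other point. *)
  have /eqP := u0 z (mem_index_enum _); rewrite (casimir_quad (fun x => u (x, z))).
  move=> /eqP; rewrite psumr_eq0 => [/allP/(_ x (mem_index_enum _)) /=|w _];
    last by apply: sumr_ge0.
  rewrite psumr_eq0 => [/allP/(_ (cA x x) (mem_index_enum _)) /=|c _];
    last exact: term_ge0.
  rewrite mulf_eq0 invr_eq0 (gt_eqF (color_count_gt0 x x)) orbF sqrf_eq0.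
  rewrite (bigD1 x) //= eqxx mul1r big1 ?addr0 => [/eqP//|y yx].
  by case: eqP => [/esym/diagA/eqP|]; rewrite ?(negPf yx) // mul0r.
move=> [x z] [x' z'].
rewrite !pairE.
(* Entry of [M^2]: for fixed [w] both denominators are fixed, and the sum over [B] is a wedge
   count. *)
transitivity (\sum_w (wedge_count cB (cA w x) (cA w x') z z')%:R
   / (N (cA w x))%:R / (N (cA w x'))%:R : F).
  apply: eq_bigr => w _; rewrite natr_sum !mulr_suml; apply: eq_bigr => v _.
  rewrite /coherent_kernel /= xpair_eqE -mulnb natrM (color_count_tr x).
  rewrite (_ : (cA x w == cB z v) = (cB v z == cA w x)).
    rewrite [cA w x' == _]eq_sym.
    by move: (_ == _)%:R (_ == _)%:R (_^-1) (_^-1) => a b d e; ring.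
  by rewrite eq_sym; apply/eqP/eqP; [apply: trBA|move/trBA].
(* By [triangle_count], wedges over [(z, z')] in [B] become wedges over [(w, x')] in [A], while the
   denominator [N (cA w x')] is replaced by [N (cB z z')]. *)
transitivity (\sum_w (wedge_count cA (cA x w) (cB z z') w x')%:R
   / (N (cA w x))%:R / (N (cB z z'))%:R : F).
  apply: eq_bigr => w _; rewrite mulrAC [RHS]mulrAC; congr (_ / _).
  have [x0 [x0' c0]] := colorsB z z'.
  have N0 : (N (cB z z'))%:R != 0 :> F by rewrite -c0 gt_eqF ?color_count_gt0.
  have N1 : (N (cA w x'))%:R != 0 :> F by rewrite gt_eqF ?color_count_gt0.
  apply/eqP; rewrite eqr_div //.
  by rewrite -!natrM triangle_count.
transitivity (\sum_u casimir x u * coherent_kernel (u, z) (x', z')); last first.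
  apply: eq_bigr => u _; rewrite (bigD1 z) //= big1 ?addr0.
    by rewrite /Z /= eqxx mul1r.
  by move=> v /negPf vz; rewrite /Z /= eq_sym vz !mul0r.
under [RHS]eq_bigr => u _ do rewrite mulr_suml.
rewrite exchange_big; apply: eq_bigr => w _ /=.
rewrite natr_sum !mulr_suml; apply: eq_bigr => u _.
rewrite (bigD1 (cA x w)) //= big1 ?addr0; last first.
  by move=> c; rewrite eq_sym => /negPf->; rewrite !mul0r.
rewrite eqxx mul1r /coherent_kernel /= xpair_eqE -mulnb natrM (color_count_tr x).
case: (cA u x' =P cB z z') => [->|_]; last by rewrite mulr0 !mul0r !mulr0.
by rewrite !mulr1 mul1r.
Qed.

End Coherent.

(** * Sherali-Adams solutions on tuples *)

Lemma big_option (V : nmodType) (T : finType) (f : option T -> V) :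
  \sum_b f b = f None + \sum_t f (Some t).
Proof.
rewrite (bigD1 None) //=; congr (_ + _).
have [/eqP T0|T0] := posnP #|T|; last first.
  have /card_gt0P [t0 _] := T0.
  rewrite (reindex_onto Some (odflt t0)) /=; last by case.
  by apply: eq_bigl => t; rewrite eqxx.
rewrite !big1 // => [t|[t|//]] _.
  by have := card0_eq (eqP T0) t.
by have := card0_eq (eqP T0) t.
Qed.

Lemma cons_behead_tuple (T : Type) k (u : k.+1.-tuple T) :
  u = cons_tuple (thead u) (behead_tuple u).
Proof. by rewrite {1}(tuple_eta u); apply/val_inj. Qed.

Lemma behead_cons_tuple (T : Type) k (a : T) (u : k.-tuple T) :
  behead_tuple (cons_tuple a u) = u.
Proof. exact/val_inj. Qed.

Lemma big_tuple_cons (V : nmodType) (T : finType) k (f : k.+1.-tuple T -> V) :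
  \sum_u f u = \sum_a \sum_(u : k.-tuple T) f (cons_tuple a u).
Proof.
rewrite pair_bigA /= (reindex (fun p : T * k.-tuple T => cons_tuple p.1 p.2)) //.
exists (fun u => (thead u, behead_tuple u)) => [[a u] _|u _] /=.
  by congr pair; apply/val_inj.
by rewrite [RHS]cons_behead_tuple.
Qed.

(* Double counting: [W] is a matrix with constant line sums whose support links
   equal values of [f] and [g]. *)
Lemma fiber_count_eq (A B : finType) (C : eqType) (W : A -> B -> rat)
    (s : rat) (f : A -> C) (g : B -> C) :
  s != 0 ->
  (forall a, \sum_b W a b = s) -> (forall b, \sum_a W a b = s) ->
  (forall a b, W a b != 0 -> f a = g b) ->
  forall c, (\sum_a (f a == c) = \sum_b (g b == c))%N.
Proof.
move=> s0 row col fg c; apply/eqP; rewrite -(eqr_nat rat).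
rewrite -(inj_eq (mulfI s0)) !natr_sum !mulr_sumr; apply/eqP.
rewrite (eq_bigr (fun a => \sum_b W a b * (f a == c)%:R)) => [|a _]; last first.
  by rewrite -mulr_suml row.
rewrite [RHS](eq_bigr (fun b => \sum_a W a b * (g b == c)%:R)) => [|b _]; last first.
  by rewrite -mulr_suml col.
rewrite exchange_big; apply: eq_bigr => b _; apply: eq_bigr => a _ /=.
by have [->|/fg->//] := eqVneq (W a b) 0; rewrite !mul0r.
Qed.

Section Weight.
Variables (G H : sgraph) (n : nat) (y : {set G * H} -> rat).

Definition pair_support (l : seq (option G * option H)) : {set G * H} :=
  [set p | (Some p.1, Some p.2) \in l].

Definition none_matched (l : seq (option G * option H)) : bool :=
  all (fun p => (p.1 == None) == (p.2 == None)) l.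

(** The dummy vertices may be matched only with each other, and such a pair imposes nothing. Passing
    through the support lets lists repeat or permute their entries. *)
Definition weight (l : seq (option G * option H)) : rat :=
  if none_matched l then y (pair_support l) else 0.

Hypothesis y_ge0 : forall I, I \in subsets_le (G * H)%type n -> 0 <= y I.
Hypothesis y_iso : forall I, I \in subsets_le (G * H)%type n ->
  ~~ partial_iso I -> y I = 0.
Hypothesis y_row : forall I, I \in subsets_le (G * H)%type (n - 1) ->
  forall g : G, \sum_(h : H) y ((g, h) |: I) = y I.
Hypothesis y_col : forall I, I \in subsets_le (G * H)%type (n - 1) ->
  forall h : H, \sum_(g : G) y ((g, h) |: I) = y I.

Lemma pair_support_cons g h l :
  pair_support ((Some g, Some h) :: l) = (g, h) |: pair_support l.
Proof.
by apply/setP => -[g' h']; rewrite !inE /= !xpair_eqE.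
Qed.

Lemma card_pair_support l : (#|pair_support l| <= size l)%N.
Proof.
have -> : #|pair_support l| =
    #|[set ((Some p.1, Some p.2) : option G * option H) | p in pair_support l]|.
  by rewrite card_imset // => -[g h] [g' h'] /= [-> ->].
apply: leq_trans (card_size l); apply/subset_leq_card/subsetP => q.
by case/imsetP => p; rewrite inE => pl ->.
Qed.

Lemma pair_support_le l k : (size l <= k)%N -> pair_support l \in subsets_le _ k.
Proof. by move=> lk; rewrite inE (leq_trans (card_pair_support l)). Qed.

Lemma pair_support_none l : pair_support ((None, None) :: l) = pair_support l.
Proof. by apply/setP => p; rewrite !inE. Qed.

Lemma weight_row l a : (size l < n)%N -> \sum_b weight ((a, b) :: l) = weight l.
Proof.
move=> ln; rewrite big_option /weight /=.
case: a => [g|] /=; last first.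
  by rewrite pair_support_none big1 // addr0.
rewrite add0r; case: ifP => _; last by rewrite big1.
under eq_bigr => h _ do rewrite pair_support_cons.
by rewrite y_row // pair_support_le // subn1 -ltnS prednK // (leq_ltn_trans _ ln).
Qed.

Lemma weight_col l b : (size l < n)%N -> \sum_a weight ((a, b) :: l) = weight l.
Proof.
move=> ln; rewrite big_option /weight /=.
case: b => [h|] /=; last first.
  by rewrite pair_support_none big1 // addr0.
rewrite add0r; case: ifP => _; last by rewrite big1.
under eq_bigr => g _ do rewrite pair_support_cons.
by rewrite y_col // pair_support_le // subn1 -ltnS prednK // (leq_ltn_trans _ ln).
Qed.

Lemma weight_ge0 l : (size l <= n)%N -> 0 <= weight l.
Proof.
by move=> ln; rewrite /weight; case: ifP => // _; rewrite y_ge0 ?pair_support_le.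
Qed.

Lemma weight_rows k (x : k.-tuple (option G)) l : (k + size l <= n)%N ->
  \sum_(z : k.-tuple (option H)) weight (zip x z ++ l) = weight l.
Proof.
elim: k => [|k IHk] in x *.
  rewrite (big_pred1 [tuple]) => [|z]; first by rewrite [x]tuple0.
  by apply/esym/eqP; exact: tuple0.
rewrite addSn => kn; rewrite big_tuple_cons exchange_big /=.
rewrite -[RHS](IHk (behead_tuple x)) 1?ltnW //; apply: eq_bigr => z _.
rewrite (tuple_eta x) /= weight_row // size_cat size_zip !size_tuple minnn.
exact: kn.
Qed.

Lemma weight_cols k (z : k.-tuple (option H)) l : (k + size l <= n)%N ->
  \sum_(x : k.-tuple (option G)) weight (zip x z ++ l) = weight l.
Proof.
elim: k => [|k IHk] in z *.
  rewrite (big_pred1 [tuple]) => [|x]; first by rewrite [z]tuple0.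
  by apply/esym/eqP; exact: tuple0.
rewrite addSn => kn; rewrite big_tuple_cons exchange_big /=.
rewrite -[RHS](IHk (behead_tuple z)) 1?ltnW //; apply: eq_bigr => x _.
rewrite (tuple_eta z) /= weight_col // size_cat size_zip !size_tuple minnn.
exact: kn.
Qed.

(** Each new pair can only lower the value, because [y J] is one of the nonnegative summands in the
    marginal sum of [y] at [J] minus that pair. *)
Lemma sherali_adams_anti (I J : {set G * H}) :
  I \subset J -> (#|J| <= n)%N -> y J <= y I.
Proof.
move: {2}#|J :\: I| (erefl #|J :\: I|) => k.
elim: k J => [|k IHk] J => [/eqP|] Jk IJ Jn.
  by rewrite cards_eq0 setD_eq0 in Jk; rewrite (_ : J = I) //; apply/eqP;
     rewrite eqEsubset Jk IJ.
have /card_gt0P [[g h]] : (0 < #|J :\: I|)%N by rewrite Jk.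
rewrite inE => /andP[gh_nI gh_J].
have Jgh : (#|J :\ (g, h)| < #|J|)%N by rewrite [X in (_ < X)%N](cardsD1 (g, h)) gh_J.
apply: le_trans (IHk (J :\ (g, h)) _ _ _); last 3 first.
- apply/eqP; rewrite -eqSS -Jk [X in _ == X](cardsD1 (g, h)) inE gh_nI gh_J.
  rewrite add1n eqSS; apply/eqP/eq_card => p; rewrite !inE.
  by do !case: (_ \in _); rewrite ?andbF ?andbT.
- by rewrite subsetD1 IJ.
- by rewrite (leq_trans (ltnW Jgh)).
have J1n : (#|J :\ (g, h)| < n)%N by rewrite (leq_trans Jgh).
rewrite -(@y_row (J :\ (g, h)) _ g); last first.
  by rewrite inE subn1 -ltnS prednK // (leq_ltn_trans _ J1n).
rewrite (bigD1 h) //= setD1K // lerDl sumr_ge0 // => h' _.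
by rewrite y_ge0 // inE (leq_trans (leq_of_leqif (leq_card_setU _ _))) // cards1.
Qed.

(** By monotonicity a positive weight survives dropping, repeating and permuting entries as well as
    inserting dummy pairs. *)
Lemma weight_sub (l l' : seq (option G * option H)) :
  (size l <= n)%N -> {subset l' <= (None, None) :: l} ->
  0 < weight l -> 0 < weight l'.
Proof.
move=> ln l'l; rewrite /weight; case: ifP => // /allP ml yl.
have -> : none_matched l'.
  apply/allP => p /l'l; rewrite inE => /predU1P[->//|]; exact: ml.
apply: lt_le_trans yl _; apply: sherali_adams_anti.
  apply/subsetP => p; rewrite !inE => /l'l; by rewrite inE.
exact: leq_trans (card_pair_support l) ln.
Qed.

End Weight.

(** * Colors of tuples *)

(** [sigma] is arbitrary: coordinates may be dropped, repeated or, through an out-of-range index,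
    replaced by the dummy [None]. *)
Definition pick_tuple (T : Type) (k : nat) (sigma : nat -> nat) (u : seq (option T)) :
    k.-tuple (option T) :=
  [tuple nth None u (sigma i) | i < k].

Lemma nth_pick_tuple (T : Type) k sigma (u : seq (option T)) i :
  nth None (pick_tuple k sigma u) i = if (i < k)%N then nth None u (sigma i) else None.
Proof.
case: ltnP => ik; last by rewrite nth_default // size_tuple.
by rewrite -(tnth_nth _ _ (Ordinal ik)) tnth_mktuple.
Qed.

Lemma eq_tuple_nth (T : Type) k (x0 : T) (u v : k.-tuple T) :
  (forall i, (i < k)%N -> nth x0 u i = nth x0 v i) -> u = v.
Proof.
by move=> uv; apply/val_inj/(@eq_from_nth _ x0); rewrite !size_tuple.
Qed.

Definition opt_edge (G : sgraph) (a b : option G) : bool :=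
  if (a, b) is (Some g, Some g') then edge g g' else false.

Section Colors.
Variables (G H : sgraph) (n : nat) (y : {set G * H} -> rat).
Hypothesis y_ge0 : forall I, I \in subsets_le (G * H)%type n -> 0 <= y I.
Hypothesis y_0 : y set0 = 1.
Hypothesis y_iso : forall I, I \in subsets_le (G * H)%type n ->
  ~~ partial_iso I -> y I = 0.
Hypothesis y_row : forall I, I \in subsets_le (G * H)%type (n - 1) ->
  forall g : G, \sum_(h : H) y ((g, h) |: I) = y I.
Hypothesis y_col : forall I, I \in subsets_le (G * H)%type (n - 1) ->
  forall h : H, \sum_(g : G) y ((g, h) |: I) = y I.

Lemma weight_nil : weight y [::] = 1.
Proof.
suff e : pair_support ([::] : seq (option G * option H)) = set0 by rewrite /weight e.
by apply/setP => p; rewrite !inE.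
Qed.

(** Prepending [(None, None)] to [l] allows [q] to be the dummy pair, so the pattern also records
    which entries are [None]. *)
Lemma weight_pattern l p q : (size l <= n)%N -> 0 < weight y l ->
  p \in (None, None) :: l -> q \in (None, None) :: l ->
  ((p.1 == q.1) = (p.2 == q.2)) * (opt_edge p.1 q.1 = opt_edge p.2 q.2).
Proof.
move=> ln; rewrite /weight; case: ifP => // /allP ml yl pl ql.
have isoI : partial_iso (pair_support l).
  by apply: contraLR yl => /y_iso-> //; rewrite pair_support_le.
have mp : (p.1 == None) = (p.2 == None).
  by move: pl; rewrite inE => /predU1P[->//|/ml/eqP].
have mq : (q.1 == None) = (q.2 == None).
  by move: ql; rewrite inE => /predU1P[->//|/ml/eqP].
case: p q pl ql mp mq => [[g|] [h|]] [[g'|] [h'|]] //=.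
rewrite !inE /= => pl ql _ _.
have /forall_inP/(_ (g, h)) := isoI; rewrite inE => /(_ pl).
move=> /forall_inP/(_ (g', h')); rewrite inE => /(_ ql) /= /andP[/eqP e1 /eqP e2].
by split; first exact: e1.
Qed.

Section Level.
Variable m : nat.
Hypothesis mn : (m <= n)%N.

Definition state : finType :=
  (m.-tuple (option G) + m.-tuple (option H))%type.

Definition state_rel : rel state := fun s s' =>
  match s, s' with
  | inl x, inr z | inr z, inl x => 0 < weight y (zip x z)
  | _, _ => false
  end.

(** A component is named by its canonical representative, so that tuples over [G] and tuples over
    [H] take colors in one type. *)
Definition color (s : state) : state := fingraph.root state_rel s.

Lemma state_rel_sym : symmetric state_rel.
Proof. by case=> x [] z. Qed.

(** The invariants of colors below come from this principle: they are checked only on single pairs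
    of positive weight. *)
Lemma color_ind (T : Type) (f : state -> T) :
  (forall (x : m.-tuple (option G)) (z : m.-tuple (option H)),
     0 < weight y (zip x z) -> f (inl x) = f (inr z)) ->
  forall s s', color s = color s' -> f s = f s'.
Proof.
move=> fe s s' /eqP; rewrite root_connect; last exact/sym_connect_sym/state_rel_sym.
case/connectP => p; elim: p s => [|s1 p IHp] s /= => [_ ->//|/andP[ss1 /IHp]].
move=> IH /IH <-; case: s s1 ss1 {IH IHp} => [x|z] [x'|z'] //= /fe //.
Qed.

Lemma color_edge (x : m.-tuple (option G)) (z : m.-tuple (option H)) :
  0 < weight y (zip x z) -> color (inl x) = color (inr z).
Proof.
move=> xz; apply/eqP; rewrite root_connect; last exact/sym_connect_sym/state_rel_sym.
exact: connect1.
Qed.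

Lemma nth_zip_tuple (x : m.-tuple (option G)) (z : m.-tuple (option H)) i :
  nth (None, None) (zip x z) i = (nth None x i, nth None z i).
Proof. by rewrite nth_zip // !size_tuple. Qed.

Lemma mem_zip_tuple (x : m.-tuple (option G)) (z : m.-tuple (option H)) i :
  (nth None x i, nth None z i) \in (None, None) :: zip x z.
Proof.
rewrite -nth_zip_tuple; have [iz|iz] := ltnP i (size (zip x z)).
  by rewrite inE mem_nth ?orbT.
by rewrite nth_default // inE eqxx.
Qed.

Lemma size_zip_tuple (x : m.-tuple (option G)) (z : m.-tuple (option H)) :
  size (zip x z) = m.
Proof. by rewrite size_zip !size_tuple minnn. Qed.

Definition state_eq (s : state) i j : bool :=
  match s with
  | inl x => nth None x i == nth None x j
  | inr z => nth None z i == nth None z j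
  end.

Definition state_edge (s : state) i j : bool :=
  match s with
  | inl x => opt_edge (nth None x i) (nth None x j)
  | inr z => opt_edge (nth None z i) (nth None z j)
  end.

Definition state_pick sigma (s : state) : state :=
  match s with
  | inl x => inl (pick_tuple m sigma x)
  | inr z => inr (pick_tuple m sigma z)
  end.

Lemma color_eq s s' i j : color s = color s' -> state_eq s i j = state_eq s' i j.
Proof.
move: s s'; apply: color_ind => x z xz /=.
have xz_n : (size (zip x z) <= n)%N by rewrite size_zip_tuple.
by case: (weight_pattern xz_n xz (mem_zip_tuple x z i) (mem_zip_tuple x z j)).
Qed.

Lemma color_opt_edge s s' i j :
  color s = color s' -> state_edge s i j = state_edge s' i j.
Proof.
move: s s'; apply: color_ind => x z xz /=.
have xz_n : (size (zip x z) <= n)%N by rewrite size_zip_tuple.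
by case: (weight_pattern xz_n xz (mem_zip_tuple x z i) (mem_zip_tuple x z j)).
Qed.

(** Position [m] is out of range and reads as [None], so comparing with it detects dummy
    coordinates. *)
Lemma state_eq_none s i : state_eq s i m =
  match s with inl x => nth None x i == None | inr z => nth None z i == None end.
Proof. by case: s => u /=; rewrite [nth None u m]nth_default // size_tuple. Qed.

Lemma weight_zip_sub k (x : k.-tuple (option G)) (z : k.-tuple (option H)) l :
  (size l <= n)%N -> 0 < weight y l ->
  (forall i, (i < k)%N -> (nth None x i, nth None z i) \in (None, None) :: l) ->
  0 < weight y (zip x z).
Proof.
move=> ln yl xzl; apply: (weight_sub y_ge0 y_row ln) yl => p /(nthP (None, None)) [i].
rewrite size_zip !size_tuple minnn => ik <-; rewrite nth_zip ?size_tuple //.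
exact: xzl.
Qed.

(** A substitution of coordinates maps edges to edges, because positive weights pass to
    subtuples. *)
Lemma color_pick sigma s s' :
  color s = color s' -> color (state_pick sigma s) = color (state_pick sigma s').
Proof.
move: s s'; apply: color_ind => x z xz /=; apply: color_edge.
have xz_n : (size (zip x z) <= n)%N by rewrite size_zip_tuple.
apply: (weight_zip_sub xz_n xz) => i im.
by rewrite !nth_pick_tuple im mem_zip_tuple.
Qed.

Definition color_size (c : state) : nat := (\sum_x (color (inl x) == c))%N.

Lemma color_sizeE c : color_size c = #|[set x | color (inl x) == c]|.
Proof.
by rewrite -sum1dep_card big_mkcond; apply: eq_bigr => x _; case: (_ == _).
Qed.

(** That [tau] undoes [sigma] on [s] is a condition on the equality pattern of [s] alone, hence on
    its color. The index [m] again stands for [None]. *)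
Lemma state_pickK sigma tau s :
  state_pick tau (state_pick sigma s) = s <->
  forall i, (i < m)%N -> state_eq s (if (tau i < m)%N then sigma (tau i) else m) i.
Proof.
have pickE (T : Type) (u : m.-tuple (option T)) i : (i < m)%N ->
    nth None (pick_tuple m tau (pick_tuple m sigma u)) i =
    nth None u (if (tau i < m)%N then sigma (tau i) else m).
  move=> im; rewrite !nth_pick_tuple im; case: ifP => // _.
  by rewrite [in RHS]nth_default // size_tuple.
case: s => u; split=> /= [[uu] i im|uE].
- by rewrite -pickE // uu.
- by congr inl; apply: (@eq_tuple_nth _ _ None) => i im; rewrite pickE //; exact/eqP/uE.
- by rewrite -pickE // uu.
- by congr inr; apply: (@eq_tuple_nth _ _ None) => i im; rewrite pickE //; exact/eqP/uE.
Qed.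

(** If [tau] undoes [sigma] on one tuple, it does so on the whole color class, so [sigma] maps this
    class injectively into the class of the image. *)
Lemma color_size_pick sigma tau s :
  state_pick tau (state_pick sigma s) = s ->
  (color_size (color s) <= color_size (color (state_pick sigma s)))%N.
Proof.
move=> /state_pickK st.
have stK (x : m.-tuple (option G)) : color (inl x) = color s ->
    pick_tuple m tau (pick_tuple m sigma x) = x.
  move=> xs; suff [//] : state_pick tau (state_pick sigma (inl x)) = inl x.
  by apply/state_pickK => i im; rewrite (color_eq _ _ xs) st.
rewrite !color_sizeE -(@card_in_imset _ _ (fun x : m.-tuple (option G) => pick_tuple m sigma x)).
  apply/subset_leq_card/subsetP => _ /imsetP[x xs ->].
  by move: xs; rewrite !inE => /eqP /(color_pick sigma) /= ->.
move=> x x'; rewrite !inE => /eqP /stK xK /eqP /stK x'K xx'.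
by rewrite -xK xx'.
Qed.

(** * The candidate Lasserre solution on lists of pairs *)

Section Value.
Variable R : realFieldType.

Definition value (l : seq (option G * option H)) : R :=
  let x := pick_tuple m id (unzip1 l) in
  let z := pick_tuple m id (unzip2 l) in
  (color (inl x) == color (inr z))%:R / (color_size (color (inl x)))%:R.

Lemma nth_pick_unzip1 (k : seq (option G * option H)) j : (size k <= m)%N ->
  nth None (pick_tuple m id (unzip1 k)) j = (nth (None, None) k j).1.
Proof.
move=> km; rewrite nth_pick_tuple; have [jk|kj] := ltnP j (size k).
  by rewrite (leq_trans jk km) (nth_map (None, None)).
by rewrite !nth_default ?size_map // if_same.
Qed.

Lemma nth_pick_unzip2 (k : seq (option G * option H)) j : (size k <= m)%N ->
  nth None (pick_tuple m id (unzip2 k)) j = (nth (None, None) k j).2.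
Proof.
move=> km; rewrite nth_pick_tuple; have [jk|kj] := ltnP j (size k).
  by rewrite (leq_trans jk km) (nth_map (None, None)).
by rewrite !nth_default ?size_map // if_same.
Qed.

(** Two lists with the same real pairs arise from each other by coordinate substitutions. These
    preserve equality of colors and, undoing each other, also the size of the class. *)
Lemma value_eq l l' : (size l <= m)%N -> (size l' <= m)%N ->
  {subset l' <= (None, None) :: l} -> {subset l <= (None, None) :: l'} ->
  value l = value l'.
Proof.
pose fst_tuple (l : seq (option G * option H)) := pick_tuple m id (unzip1 l).
pose snd_tuple (l : seq (option G * option H)) := pick_tuple m id (unzip2 l).
(* An entry missing from [k] gets the index [size k], which reads as [(None, None)]; under the
   inclusion of entries this is the right value. *)
pose sigma (k k' : seq (option G * option H)) i := index (nth (None, None) k' i) k.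
have nth_sigma k k' i : {subset k' <= (None, None) :: k} ->
    nth (None, None) k (sigma k k' i) = nth (None, None) k' i.
  move=> k'k; have [|k'i] := boolP (nth (None, None) k' i \in k).
    exact: nth_index.
  rewrite nth_default; last by rewrite leqNgt index_mem.
  have [ik'|k'i_le] := ltnP i (size k'); last by rewrite nth_default.
  have := k'k _ (mem_nth (None, None) ik').
  by rewrite inE (negPf k'i) orbF => /eqP.
have pick1 k k' : (size k <= m)%N -> (size k' <= m)%N ->
    {subset k' <= (None, None) :: k} ->
    pick_tuple m (sigma k k') (fst_tuple k) = fst_tuple k'.
  move=> km k'm k'k; apply: (@eq_tuple_nth _ _ None) => i im.
  by rewrite nth_pick_tuple im !nth_pick_unzip1 // nth_sigma.
have pick2 k k' : (size k <= m)%N -> (size k' <= m)%N ->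
    {subset k' <= (None, None) :: k} ->
    pick_tuple m (sigma k k') (snd_tuple k) = snd_tuple k'.
  move=> km k'm k'k; apply: (@eq_tuple_nth _ _ None) => i im.
  by rewrite nth_pick_tuple im !nth_pick_unzip2 // nth_sigma.
move=> lm l'm l'l ll'.
rewrite /value /= -/(fst_tuple l) -/(snd_tuple l) -/(fst_tuple l') -/(snd_tuple l').
have p1 := pick1 _ _ lm l'm l'l; have p2 := pick2 _ _ lm l'm l'l.
have q1 := pick1 _ _ l'm lm ll'; have q2 := pick2 _ _ l'm lm ll'.
have -> : color_size (color (inl (fst_tuple l))) =
          color_size (color (inl (fst_tuple l'))).
  have A : state_pick (sigma l l') (inl (fst_tuple l)) = inl (fst_tuple l').
    by congr inl.
  have B : state_pick (sigma l' l) (inl (fst_tuple l')) = inl (fst_tuple l).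
    by congr inl.
  apply/eqP; rewrite eqn_leq; apply/andP; split.
    by rewrite -A; apply: (@color_size_pick _ (sigma l' l)); rewrite A B.
  by rewrite -B; apply: (@color_size_pick _ (sigma l l')); rewrite B A.
congr (_%:R / _); congr nat_of_bool; apply/eqP/eqP.
  by move=> /(color_pick (sigma l l')) /=; rewrite p1 p2.
by move=> /(color_pick (sigma l' l)) /=; rewrite q1 q2.
Qed.

(** The tuple of dummies is alone among the [G]-tuples of its color, since colors show which
    coordinates are [None]. *)
Lemma value_nil : value [::] = 1.
Proof.
rewrite /value /=; set x := pick_tuple m id _; set z := pick_tuple m id _.
have nx i : nth None x i = None by rewrite nth_pick_tuple nth_nil if_same.
have nz i : nth None z i = None by rewrite nth_pick_tuple nth_nil if_same.
have xz : color (inl x) = color (inr z).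
  apply: color_edge; apply: (@weight_zip_sub _ _ _ [::]) => //.
    by rewrite weight_nil.
  by move=> i _; rewrite nx nz inE eqxx.
rewrite xz eqxx -xz (_ : color_size _ = 1%N) ?invr1 ?mulr1 //.
rewrite /color_size (bigD1 x) //= eqxx big1 // => u ux.
case: eqP => // /color_eq ue; case/eqP: ux; apply: (@eq_tuple_nth _ _ None) => i im.
by rewrite nx; have := ue i m; rewrite !state_eq_none nx eqxx => /eqP.
Qed.

Lemma value_partial_iso l : (size l <= m)%N -> value l != 0 ->
  partial_iso (pair_support l).
Proof.
move=> lm; rewrite /value /=.
case: (_ =P color _) => [xz _|_]; last by rewrite mul0r eqxx.
apply/forall_inP => -[g h]; rewrite inE => /= /(nthP (None, None)) [i _ li].
apply/forall_inP => -[g' h']; rewrite inE => /= /(nthP (None, None)) [j _ lj].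
have := color_eq i j xz; have := color_opt_edge i j xz.
rewrite /= !nth_pick_unzip1 // !nth_pick_unzip2 // li lj /opt_edge /= => -> e.
by rewrite eqxx andbT; apply/eqP.
Qed.

Lemma value_unmatched l p : (size l <= m)%N -> value l != 0 ->
  p \in l -> (p.1 == None) = (p.2 == None).
Proof.
move=> lm; rewrite /value /=.
case: (_ =P color _) => [xz _|_]; last by rewrite mul0r eqxx.
move=> /(nthP (None, None)) [i _ <-]; have := color_eq i m xz.
by rewrite !state_eq_none nth_pick_unzip1 // nth_pick_unzip2.
Qed.

End Value.
End Level.

(** * Marginal sums of the candidate solution *)

Section Marginal.
Variable m' : nat.
Local Notation m := m'.+1.
Hypothesis mn : (m <= n)%N.
Local Notation color := (@color m).
Local Notation color_size := (@color_size m).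

Definition state_cons_count (c : state m) (s : state m') : nat :=
  match s with
  | inl x => (\sum_a (color (inl (cons_tuple a x)) == c))%N
  | inr z => (\sum_b (color (inr (cons_tuple b z)) == c))%N
  end.

Definition state_none_cons (s : state m') : state m :=
  match s with
  | inl x => inl (cons_tuple None x)
  | inr z => inr (cons_tuple None z)
  end.

(** The weights of the one-point extensions of [zip x z] form the matrix for double counting.
    Prepending [None] turns shorter tuples into [m]-tuples, so that one level of colors suffices. *)
Lemma state_cons_count_inv c s s' :
  color (state_none_cons s) = color (state_none_cons s') ->
  state_cons_count c s = state_cons_count c s'.
Proof.
(* [f] ignores the head of a tuple; it lifts the count to [m]-tuples, where [color_ind] applies. *)
pose f (u : state m) := match u with
  | inl x => state_cons_count c (inl (behead_tuple x))
  | inr z => state_cons_count c (inr (behead_tuple z)) end.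
have fE u : f (state_none_cons u) = state_cons_count c u.
  by case: u => u; rewrite /f /= behead_cons_tuple.
rewrite -!fE; apply: (color_ind (f := f)) => x z.
rewrite (cons_behead_tuple x) (cons_behead_tuple z).
move: (thead x) (thead z) (behead_tuple x) (behead_tuple z) => a b {}x {}z.
move=> xz; rewrite /f !behead_cons_tuple.
have sz : size (zip x z) = m' by rewrite size_zip !size_tuple minnn.
have xz_gt0 : 0 < weight y (zip x z).
  apply: (weight_sub y_ge0 y_row _ _ xz); first by rewrite /= sz.
  by move=> p pxz; rewrite /= !inE pxz !orbT.
apply: (@fiber_count_eq _ _ _ (fun a b => weight y ((a, b) :: zip x z))
  (weight y (zip x z)) (fun a => color (inl (cons_tuple a x)))
  (fun b => color (inr (cons_tuple b z)))) => [|a'|b'|a' b' nz].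
- by rewrite gt_eqF.
- by rewrite (weight_row y_row) // sz.
- by rewrite (weight_col y_col) // sz.
- by apply: color_edge; rewrite /= lt_def nz (weight_ge0 y_ge0) //= sz.
Qed.

(** Sending position 0 to the out-of-range index [m] blanks the head, so the color of an extension
    determines the color of the [None]-padded tuple. *)
Lemma state_cons_count_gt0 c s : (0 < state_cons_count c s)%N ->
  color (state_none_cons s) =
  color (state_pick (fun i => if i == 0%N then m else i) c).
Proof.
have pick0 (T : Type) (a : option T) (u : m'.-tuple (option T)) :
    pick_tuple m (fun i => if i == 0%N then m else i) (cons_tuple a u) =
    cons_tuple None u.
  apply: (@eq_tuple_nth _ _ None) => i im; rewrite nth_pick_tuple im.
  by case: i im => //= _; rewrite nth_default // size_tuple.
have key u : color u = c -> color (state_pick (fun i => if i == 0%N then m else i) u) =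
    color (state_pick (fun i => if i == 0%N then m else i) c).
  move=> uc; apply: (color_pick mn); rewrite -uc.
  by apply/esym/fingraph.root_root; apply/sym_connect_sym/state_rel_sym.
case: s => x; rewrite lt0n sum_nat_eq0 => /forallPn [a];
  rewrite implyTb eqb0 negbK => /eqP ac.
  by rewrite -(key _ ac) /= pick0.
by rewrite -(key _ ac) /= pick0.
Qed.

(** Deleting the head fibers the class of [c] over the tuples whose [None]-padding has the color of
    [state_none_cons s]; by invariance all fibers have the same size. *)
Lemma color_size_cons c s : (0 < state_cons_count c s)%N ->
  color_size c = (state_cons_count c s * color_size (color (state_none_cons s)))%N.
Proof.
move=> cs; set d := color (state_none_cons s).
have sizeE e : color_size e = (\sum_x state_cons_count e (inl x))%N.
  by rewrite /color_size big_tuple_cons exchange_big.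
rewrite !sizeE big_distrr; apply: eq_bigr => x _ /=.
(* Only the head [None] can give the color [d], because colors detect dummy coordinates. *)
have -> : (\sum_a (color (inl (cons_tuple a x)) == d) =
           (color (state_none_cons (inl x)) == d))%N.
  rewrite (bigD1 None) //= big1 ?addn0 // => a aN.
  case: eqP => // /(color_eq mn 0%N m); rewrite !state_eq_none /=.
  by case: s {cs} @d => u /=; rewrite (negPf aN).
have [xd|xd] := eqVneq.
  by rewrite muln1 -(state_cons_count_inv c xd).
rewrite muln0; apply/eqP; rewrite -leqn0 leqNgt; apply: contra xd => xc.
by rewrite (@state_cons_count_gt0 c (inl x)) // /d (state_cons_count_gt0 cs).
Qed.

Section MarginalValue.
Variable R : realFieldType.
Local Notation value := (@value m R).

Lemma pick_tuple_cons (T : Type) (a : option T) u :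
  pick_tuple m id (a :: u) = cons_tuple a (pick_tuple m' id u).
Proof.
apply: (@eq_tuple_nth _ _ None) => i im; rewrite nth_pick_tuple im.
case: i im => // i im; rewrite -[RHS]/(nth None (pick_tuple m' id u) i).
by rewrite nth_pick_tuple -ltnS im.
Qed.

(** The numerators count the extensions of the [H]-tuple that have the color of the extended
    [G]-tuple; [color_size_cons] cancels this count against the class size. *)
Lemma value_row (l : seq (option G * option H)) a :
  \sum_b value ((a, b) :: l) = value ((None, None) :: l).
Proof.
rewrite /value /= !pick_tuple_cons.
under eq_bigr => b _ do rewrite pick_tuple_cons eq_sym.
move: (pick_tuple m' id (unzip1 l)) (pick_tuple m' id (unzip2 l)) => x z.
set c := color (inl (cons_tuple a x)); rewrite -mulr_suml -natr_sum.
rewrite (_ : (\sum_b _)%N = state_cons_count c (inr z)) //.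
have cx : (0 < state_cons_count c (inl x))%N.
  by rewrite /= (bigD1 a) //= eqxx.
case: eqP => xz.
  have e := @state_cons_count_inv c (inl x) (inr z) xz.
  rewrite -e (color_size_cons cx) natrM invfM mulrA divff ?mul1r //.
  by rewrite pnatr_eq0 -lt0n.
(* When the padded tuples have different colors, no extension of [z] can have color [c]. *)
have [->|/state_cons_count_gt0 cz] := posnP (state_cons_count c (inr z)).
  by rewrite !mul0r.
by case: xz; rewrite -[LHS]/(color (state_none_cons (inl x))) (state_cons_count_gt0 cx).
Qed.

Lemma value_col (l : seq (option G * option H)) b :
  \sum_a value ((a, b) :: l) = value ((None, None) :: l).
Proof.
rewrite /value /= !pick_tuple_cons.
under eq_bigr => a _ do rewrite pick_tuple_cons.
move: (pick_tuple m' id (unzip1 l)) (pick_tuple m' id (unzip2 l)) => x z.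
set d := color (inr (cons_tuple b z)).
(* The denominator varies with [a], but it is the size of [d] wherever the indicator is nonzero. *)
rewrite (eq_bigr (fun a => (color (inl (cons_tuple a x)) == d)%:R
  / (color_size d)%:R)) => [|a _]; last first.
  by case: eqP => [->|]; rewrite ?mul0r.
rewrite -mulr_suml -natr_sum (_ : (\sum_a _)%N = state_cons_count d (inl x)) //.
have dz : (0 < state_cons_count d (inr z))%N.
  by rewrite /= (bigD1 b) //= eqxx.
case: eqP => xz.
  have e := @state_cons_count_inv d (inl x) (inr z) xz.
  rewrite -e in dz; rewrite (color_size_cons dz) natrM invfM mulrA divff ?mul1r //.
  by rewrite pnatr_eq0 -lt0n.
have [->|/state_cons_count_gt0 dx] := posnP (state_cons_count d (inl x)).
  by rewrite !mul0r.
by case: xz; rewrite -[RHS]/(color (state_none_cons (inr z))) (state_cons_count_gt0 dz).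
Qed.

End MarginalValue.
End Marginal.

(** * Coherence of the colorings of pairs of [t]-tuples *)

Section Coherence.
Variables (t : nat) (R : realFieldType).
Hypothesis t3n : (t + (t + t) <= n)%N.
Local Notation m := (t + t)%N.
Local Notation X := (t.-tuple (option G)).
Local Notation Z := (t.-tuple (option H)).

Let mn : (m <= n)%N. Proof. exact: leq_trans (leq_addl _ _) t3n. Qed.

Definition colorG (x x' : X) : state m := @color m (inl (cat_tuple x x')).
Definition colorH (z z' : Z) : state m := @color m (inr (cat_tuple z z')).

Let fst_half (T : Type) (u : m.-tuple (option T)) : t.-tuple (option T) :=
  pick_tuple t id u.
Let snd_half (T : Type) (u : m.-tuple (option T)) : t.-tuple (option T) :=
  pick_tuple t (addn t) u.

Let fst_half_cat (T : Type) (u v : t.-tuple (option T)) : fst_half (cat_tuple u v) = u.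
Proof.
by apply: (@eq_tuple_nth _ _ None) => i it; rewrite nth_pick_tuple it nth_cat size_tuple it.
Qed.

Let snd_half_cat (T : Type) (u v : t.-tuple (option T)) : snd_half (cat_tuple u v) = v.
Proof.
apply: (@eq_tuple_nth _ _ None) => i it; rewrite nth_pick_tuple it nth_cat size_tuple.
by rewrite ltnNge leq_addr /= addKn.
Qed.

Let cat_halves (T : Type) (u : m.-tuple (option T)) :
  cat_tuple (fst_half u) (snd_half u) = u.
Proof.
apply: (@eq_tuple_nth _ _ None) => i im; rewrite nth_cat size_tuple nth_pick_tuple.
have [//|ti] := ltnP i t; rewrite nth_pick_tuple subnKC //.
by rewrite ltn_subLR // im.
Qed.

Lemma big_tuple_cat (T : finType) (f : m.-tuple (option T) -> nat) :
  (\sum_u f u = \sum_(x : t.-tuple (option T)) \sum_(x' : t.-tuple (option T))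
                   f (cat_tuple x x'))%N.
Proof.
rewrite pair_bigA /=.
rewrite (reindex (fun p : t.-tuple (option T) * t.-tuple (option T) =>
                    cat_tuple p.1 p.2)) //.
exists (fun u => (fst_half u, snd_half u)) => [[u v] _|u _] /=.
  by rewrite fst_half_cat snd_half_cat.
exact: cat_halves.
Qed.

Lemma color_count_colorG c : color_count colorG c = @color_size m c.
Proof. by rewrite /color_size big_tuple_cat. Qed.

Let swap i := if (i < t)%N then (t + i)%N else (i - t)%N.

Let pick_swap (T : Type) (u v : t.-tuple (option T)) :
  pick_tuple m swap (cat_tuple u v) = cat_tuple v u.
Proof.
apply: (@eq_tuple_nth _ _ None) => i im; rewrite nth_pick_tuple im !nth_cat !size_tuple.
rewrite /swap; case: (ltnP i t) => [it|ti]; first by rewrite ltnNge leq_addr /= addKn.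
by rewrite ltn_subLR // im.
Qed.

Lemma colorG_tr x1 x2 x1' x2' :
  colorG x1 x2 = colorG x1' x2' -> colorG x2 x1 = colorG x2' x1'.
Proof. by move/(color_pick mn swap); rewrite /= !pick_swap. Qed.

Lemma colorGH_tr x x' z z' : colorG x x' = colorH z z' -> colorG x' x = colorH z' z.
Proof. by move/(color_pick mn swap); rewrite /= !pick_swap. Qed.

Lemma colorG_diag x u v : colorG x x = colorG u v -> u = v.
Proof.
move=> e; apply: (@eq_tuple_nth _ _ None) => i it.
have := color_eq mn i (t + i) e; rewrite /= !nth_cat !size_tuple it.
by rewrite ltnNge leq_addr /= addKn eqxx => /esym/eqP.
Qed.

(** The weights of all [G]-tuples against a fixed [H]-tuple sum to 1, so one of them is positive. *)
Lemma colorH_colorG z z' : exists x x', colorG x x' = colorH z z'.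
Proof.
have := @weight_cols _ _ n y y_col _ (cat_tuple z z') [::].
rewrite addn0 weight_nil => /(_ mn) w1.
have [u u0|w0] := pickP (fun x : m.-tuple (option G) =>
    weight y (zip x (cat_tuple z z') ++ [::]) != 0); last first.
  have : \sum_(x : m.-tuple (option G)) weight y (zip x (cat_tuple z z') ++ [::]) = 0.
    by apply: big1 => x _; have /negbFE/eqP := w0 x.
  by rewrite w1 => /eqP; rewrite oner_eq0.
exists (fst_half u), (snd_half u); rewrite /colorG cat_halves.
apply: color_edge; move: u0; rewrite cats0 lt_def => ->.
by rewrite (weight_ge0 y_ge0) // size_zip_tuple.
Qed.

Definition state_wedge (a b : state m) (s : state m) : nat :=
  match s with
  | inl u => wedge_count colorG a b (fst_half u) (snd_half u)
  | inr v => wedge_count colorH a b (fst_half v) (snd_half v)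
  end.

(** The double counting attaches a pair of [t]-tuples to a pair of [2t]-tuples of positive weight;
    these lists of [3t] pairs are the reason for level [3t]. *)
Lemma state_wedge_inv a b s s' : @color m s = @color m s' ->
  state_wedge a b s = state_wedge a b s'.
Proof.
move: s s'; apply: color_ind => u v uv /=.
have uv_m : size (zip u v) = m by rewrite size_zip_tuple.
pose W (x : X) (z : Z) := weight y (zip x z ++ zip u v).
have W_n (x : X) (z : Z) : (size (zip x z ++ zip u v) <= n)%N.
  by rewrite size_cat uv_m size_zip_tuple.
rewrite /wedge_count.
apply: (@fiber_count_eq _ _ _ W (weight y (zip u v))
   (fun x => (colorG x (fst_half u), colorG x (snd_half u)))
   (fun z => (colorH z (fst_half v), colorH z (snd_half v)))) => [|x|z|x z Wxz].
- by rewrite gt_eqF.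
- by rewrite (@weight_rows _ _ n y y_row) // uv_m.
- by rewrite (@weight_cols _ _ n y y_col) // uv_m.
have {}Wxz : 0 < weight y (zip x z ++ zip u v).
  by rewrite lt_def Wxz (weight_ge0 y_ge0).
have mem_l i : (nth None x i, nth None z i) \in (None, None) :: zip x z ++ zip u v.
  by have := mem_zip_tuple x z i; rewrite !inE mem_cat; case/orP => ->; rewrite ?orbT.
have mem_r i : (nth None u i, nth None v i) \in (None, None) :: zip x z ++ zip u v.
  by have := mem_zip_tuple u v i; rewrite !inE mem_cat; case/orP => ->; rewrite ?orbT.
congr pair; apply: color_edge; apply: (weight_zip_sub (W_n x z) Wxz) => i im;
  rewrite !nth_cat !size_tuple; (case: (ltnP i t) => it; first exact: mem_l);
  by rewrite !nth_pick_tuple; case: ifP => _; rewrite ?mem_r // inE.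
Qed.

Lemma state_wedgeG a b x x' :
  state_wedge a b (inl (cat_tuple x x')) = wedge_count colorG a b x x'.
Proof. by rewrite /= fst_half_cat snd_half_cat. Qed.

Lemma state_wedgeH a b z z' :
  state_wedge a b (inr (cat_tuple z z')) = wedge_count colorH a b z z'.
Proof. by rewrite /= fst_half_cat snd_half_cat. Qed.

Lemma color_kernel_psd : psd_kernel (@coherent_kernel R _ _ _ colorG colorH).
Proof.
apply: coherent_kernel_psd.
- exact: colorG_tr.
- exact: colorGH_tr.
- by move=> x x' z z' e; apply/esym/colorGH_tr/esym.
- by move=> x x' u u' a b e; rewrite -!state_wedgeG; apply: state_wedge_inv.
- by move=> x x' z z' a b e; rewrite -state_wedgeG -state_wedgeH; apply: state_wedge_inv.
- exact: colorG_diag.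
- exact: colorH_colorG.
Qed.

Lemma coherent_kernel_value (x x' : X) (z z' : Z) :
  @coherent_kernel R _ _ _ colorG colorH (x, z) (x', z') =
  @value m R (zip (cat_tuple x x') (cat_tuple z z')).
Proof.
rewrite /coherent_kernel /value /= color_count_colorG unzip1_zip ?unzip2_zip;
  rewrite ?size_cat ?size_tuple //.
have pick_id (T : Type) (u : m.-tuple (option T)) : pick_tuple m id u = u.
  by apply: (@eq_tuple_nth _ _ None) => i im; rewrite nth_pick_tuple im.
by rewrite !(pick_id _ (cat_tuple _ _)).
Qed.

End Coherence.
End Colors.

(** * From Sherali-Adams to Lasserre *)

Definition lift_pairs (G H : finType) (I : {set G * H}) : seq (option G * option H) :=
  [seq (Some p.1, Some p.2) | p <- enum I].

Lemma mem_lift_pairs (G H : finType) (I : {set G * H}) p :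
  (p \in lift_pairs I) = if p is (Some g, Some h) then (g, h) \in I else false.
Proof.
apply/mapP/idP => [[[g h]]|].
  by rewrite mem_enum => gI ->.
by case: p => [[g|] [h|]] // ghI; exists (g, h); rewrite ?mem_enum.
Qed.

Lemma size_lift_pairs (G H : finType) (I : {set G * H}) : size (lift_pairs I) = #|I|.
Proof. by rewrite size_map cardE. Qed.

Lemma pair_support_lift (G H : sgraph) (I : {set G * H}) :
  pair_support (lift_pairs I) = I.
Proof. by apply/setP => -[g h]; rewrite inE mem_lift_pairs. Qed.

Lemma nth_zip_pick (G H : sgraph) k (l : seq (option G * option H)) i :
  (size l <= k)%N ->
  nth (None, None) (zip (pick_tuple k id (unzip1 l)) (pick_tuple k id (unzip2 l))) i =
  nth (None, None) l i.
Proof.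
move=> lk; rewrite nth_zip ?size_tuple //.
by rewrite nth_pick_unzip1 // nth_pick_unzip2 //; case: (nth _ l i).
Qed.

Lemma mem_zip_pick (G H : sgraph) k (l : seq (option G * option H)) p :
  (size l <= k)%N -> p \in l ->
  p \in zip (pick_tuple k id (unzip1 l)) (pick_tuple k id (unzip2 l)).
Proof.
move=> lk /(nthP (None, None)) [i il <-]; rewrite -(nth_zip_pick _ lk).
by apply: mem_nth; rewrite size_zip !size_tuple minnn (leq_trans il).
Qed.

Lemma zip_pick_mem (G H : sgraph) k (l : seq (option G * option H)) p :
  (size l <= k)%N ->
  p \in zip (pick_tuple k id (unzip1 l)) (pick_tuple k id (unzip2 l)) ->
  p \in (None, None) :: l.
Proof.
move=> lk /(nthP (None, None)) [i _ <-]; rewrite nth_zip_pick //.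
have [il|il] := ltnP i (size l); first by rewrite inE mem_nth ?orbT.
by rewrite nth_default // inE eqxx.
Qed.

Lemma sherali_adams_lasserre (R : realType) (G H : sgraph) (t : nat) :
  (0 < t)%N -> sherali_adams (3 * t) G H -> lasserre R t G H.
Proof.
(* Writing [t] as a successor makes [t + t] convertible to a successor, the form used for the
   marginal sums. *)
case: t => // t' _; set t := t'.+1 => -[y [y_ge0 y_0 y_iso y_row y_col]].
have t3n : (t + (t + t) <= 3 * t)%N by lia.
have mn : (t + t <= 3 * t)%N by lia.
pose val := @value G H y (t + t) R.
have val_eq l l' : (size l <= t + t)%N -> (size l' <= t + t)%N ->
    {subset l' <= (None, None) :: l} -> {subset l <= (None, None) :: l'} ->
    val l = val l'.
  exact: (value_eq y_ge0 y_iso y_row mn).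
have val_cons g h (I : {set G * H}) : (#|I| < t + t)%N ->
    val (lift_pairs ((g, h) |: I)) = val ((Some g, Some h) :: lift_pairs I).
  move=> It; apply: val_eq.
  - by rewrite size_lift_pairs cardsU1; case: (_ \notin _); lia.
  - by rewrite /= size_lift_pairs.
  - move=> p; rewrite !inE !mem_lift_pairs.
    by case: p => [[g'|] [h'|]]; rewrite ?inE !xpair_eqE ?andbF ?orbF.
  - move=> p; rewrite !inE !mem_lift_pairs.
    by case: p => [[g'|] [h'|]]; rewrite ?inE !xpair_eqE ?andbF ?orbF.
have val_none (I : {set G * H}) : (#|I| < t + t)%N ->
    val ((None, None) :: lift_pairs I) = val (lift_pairs I).
  move=> It; apply: val_eq; rewrite /= ?size_lift_pairs ?(ltnW It) //.
  by move=> p pI; rewrite !inE pI !orbT.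
have val_row a (I : {set G * H}) :
    \sum_b val ((a, b) :: lift_pairs I) = val ((None, None) :: lift_pairs I).
  exact: (value_row y_ge0 y_iso y_row y_col mn).
have val_col b (I : {set G * H}) :
    \sum_a val ((a, b) :: lift_pairs I) = val ((None, None) :: lift_pairs I).
  exact: (value_col y_ge0 y_iso y_row y_col mn).
exists (fun I => val (lift_pairs I)); split.
(* [r] lists a set as a pair of padded [t]-tuples. The kernel at [r I] and [r J] is the value of the
   concatenated lists, which depends only on [I :|: J]. *)
- pose r (I : {set G * H}) := (pick_tuple t id (unzip1 (lift_pairs I)),
                               pick_tuple t id (unzip2 (lift_pairs I))).
  have psdM := color_kernel_psd (R := R) y_ge0 y_0 y_iso y_row y_col t3n.
  apply: (@psd_kernel_moment R _ _ _ _ _ r psdM) => I J It Jt.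
  rewrite /r coherent_kernel_value; apply: val_eq.
  + by rewrite size_zip !size_tuple minnn.
  + rewrite size_lift_pairs (leq_trans (leq_of_leqif (leq_card_setU _ _))) //.
    exact: leq_add.
  + move=> p; rewrite !inE zip_cat ?size_tuple // mem_cat.
    case: p => [[g|] [h|]]; rewrite mem_lift_pairs //= in_setU.
    case/orP => pI.
      have := @mem_zip_pick _ _ t (lift_pairs I) (Some g, Some h).
      by rewrite size_lift_pairs mem_lift_pairs => /(_ It pI) ->.
    have := @mem_zip_pick _ _ t (lift_pairs J) (Some g, Some h).
    by rewrite size_lift_pairs mem_lift_pairs => /(_ Jt pI) ->; rewrite orbT.
  + move=> p; rewrite zip_cat ?size_tuple // mem_cat.
    have sub (K : {set G * H}) : (#|K| <= t)%N -> K \subset I :|: J ->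
        p \in zip (r K).1 (r K).2 -> p \in (None, None) :: lift_pairs (I :|: J).
      move=> Kt /subsetP KIJ /zip_pick_mem; rewrite size_lift_pairs => /(_ Kt).
      rewrite !inE => /orP[->//|]; rewrite !mem_lift_pairs.
      by case: p => [[g|] [h|]] //= /KIJ ->.
    by case/orP; apply: sub; rewrite ?subsetUl ?subsetUr.
- move=> I; rewrite inE => It g.
  have {}It : (#|I| < t + t)%N by lia.
  under eq_bigr => h _ do rewrite val_cons //.
  rewrite -val_none // -(val_row (Some g)).
  (* The term for [None] vanishes: tuples of equal color never match a real vertex with the
     dummy. *)
  rewrite big_option [X in X + _](_ : _ = 0) ?add0r //.
  apply/eqP/negPn/negP => nz.
  have := value_unmatched y_iso mn _ nz (mem_head _ _).
  by rewrite /= size_lift_pairs => /(_ It).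
- move=> I; rewrite inE => It h.
  have {}It : (#|I| < t + t)%N by lia.
  under eq_bigr => g _ do rewrite val_cons //.
  rewrite -val_none // -(val_col (Some h)).
  rewrite big_option [X in X + _](_ : _ = 0) ?add0r //.
  apply/eqP/negPn/negP => nz.
  have := value_unmatched y_iso mn _ nz (mem_head _ _).
  by rewrite /= size_lift_pairs => /(_ It).
- move=> I; rewrite inE => It nisoI; apply/eqP; apply: contraNT nisoI.
  move=> /(value_partial_iso y_iso mn); rewrite pair_support_lift size_lift_pairs.
  by apply; lia.
- rewrite /lift_pairs enum_set0 /= /val.
  exact: (value_nil y_ge0 y_0 y_iso y_row mn).
Qed.

(** * From Lasserre to Sherali-Adams *)

Lemma rat_near (R : realType) (u e : R) : 0 < e -> exists q : rat, `|ratr q - u| < e.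
Proof.
move=> e0; have /rat_in_itvoo [q] : u - e < u + e by lra.
rewrite in_itv /= => /andP[q1 q2]; exists q; rewrite ltr_norml; apply/andP; split; lra.
Qed.

(* The real solution is a real combination of rational solutions supported where
   it is; perturbing the coefficients to rationals preserves strict positivity. *)
Lemma rational_nonneg_solution (R : realType) (K C : finType)
    (A : C -> K -> rat) (x : K -> R) :
  (forall k, 0 <= x k) ->
  (forall c, \sum_k ratr (A c k) * x k = 0) ->
  exists x' : K -> rat,
    [/\ forall k, 0 <= x' k,
        forall k, (x' k == 0) = (x k == 0)
      & forall c, \sum_k A c k * x' k = 0].
Proof.
move=> x0 Ax.
have sumK (V : nmodType) (f : K -> V) : \sum_k f k = \sum_(i < #|K|) f (enum_val i).
  rewrite (reindex (fun i : 'I_#|K| => enum_val i)) //.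
  exact/onW_bij/enum_val_bij.
(* The last columns force the coordinates where [x] vanishes to vanish as well. *)
pose B : 'M[rat]_(#|K|, #|C| + #|K|) :=
  row_mx (\matrix_(i, j) A (enum_val j) (enum_val i))
         (\matrix_(i, j) ((i == j) && (x (enum_val i) == 0))%:R).
pose xv : 'rV[R]_#|K| := \row_i x (enum_val i).
have xB : xv *m map_mx ratr B = 0.
  rewrite map_row_mx mul_mx_row; apply/rowP => j; rewrite !mxE.
  case: splitP => j' _; rewrite !mxE.
    rewrite -[RHS](Ax (enum_val j')) sumK; apply: eq_bigr => i _.
    by rewrite !mxE mulrC.
  apply: big1 => i _; rewrite !mxE ratr_nat.
  by case: (x _ =P 0) => [->|_]; rewrite ?mul0r // andbF mulr0.
(* Kernels commute with field extension, so [x] is a real combination of rational kernel vectors. *)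
have /submxP [u xu] : (xv <= map_mx ratr (kermx B))%MS.
  by rewrite map_kermx; apply/sub_kermxP.
pose Kr i j : R := ratr (kermx B i j).
have xE j : x (enum_val j) = \sum_i u 0 i * Kr i j.
  have := congr1 (fun M : 'rV_ _ => M 0 j) xu; rewrite !mxE => ->.
  by apply: eq_bigr => i _; rewrite mxE.
(* With this [e] the perturbation stays below every positive coordinate of [x]. Coordinates equal to
   0 add nothing to the sum, as the inverse of zero is zero. *)
pose e := (1 + \sum_j \sum_i `|Kr i j| / x (enum_val j))^-1.
have S0 j : 0 <= \sum_i `|Kr i j| / x (enum_val j).
  by apply: sumr_ge0 => i _; rewrite mulr_ge0 ?invr_ge0.
have S1 : 0 < 1 + \sum_j \sum_i `|Kr i j| / x (enum_val j).
  by rewrite ltr_pwDl // sumr_ge0.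
have e0 : 0 < e by rewrite invr_gt0.
have [q qu] : exists q : 'I_#|K| -> rat, forall i, `|ratr (q i) - u 0 i| < e.
  exists (fun i => xchoose (rat_near (u 0 i) e0)) => i.
  exact: (xchooseP (rat_near (u 0 i) e0)).
pose z : 'rV[rat]_#|K| := (\row_i q i) *m kermx B.
have zB : z *m B = 0 by rewrite -mulmxA mulmx_ker mulmx0.
have z0 j : x (enum_val j) = 0 -> z 0 j = 0.
  move=> xj; have := congr1 (fun M : 'rV_ _ => M 0 (rshift #|C| j)) zB.
  rewrite mul_mx_row row_mxEr !mxE (bigD1 j) //= big1 ?addr0 => [|i /negPf ij].
    by rewrite !mxE eqxx xj eqxx mulr1.
  by rewrite !mxE ij mulr0.
have z_gt0 j : 0 < x (enum_val j) -> 0 < z 0 j.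
  move=> xj; rewrite -(ltr_rat R) rmorph0.
  have -> : ratr (z 0 j) = x (enum_val j) + \sum_i (ratr (q i) - u 0 i) * Kr i j :> R.
    rewrite xE -big_split mxE rmorph_sum; apply: eq_bigr => i _ /=.
    by rewrite mxE rmorphM /Kr; ring.
  have : `|\sum_i (ratr (q i) - u 0 i) * Kr i j| <= e * \sum_i `|Kr i j|.
    rewrite mulr_sumr; apply: le_trans (ler_norm_sum _ _ _) _.
    by apply: ler_sum => i _; rewrite normrM ler_wpM2r // ltW.
  suff : e * (\sum_i `|Kr i j|) < x (enum_val j).
    by move=> h1 /ler_normlP [h2 h3]; lra.
  rewrite mulrC ltr_pdivrMr // -ltr_pdivrMl // mulrC mulr_suml.
  rewrite [\sum_(j' < _) \sum_(i < _) _](bigD1 j) //=; have := S0 j.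
  have : 0 <= \sum_(j' | j' != j) \sum_i `|Kr i j'| / x (enum_val j').
    by apply: sumr_ge0 => j' _; apply: S0.
  lra.
exists (fun k => z 0 (enum_rank k)); split=> [k|k|c].
- have := x0 k; rewrite -{1}[k]enum_rankK le_eqVlt => /orP[/eqP/esym/z0->//|].
  by move/z_gt0/ltW.
- have := x0 k; rewrite -[k in x k]enum_rankK le_eqVlt => /orP[/eqP/esym|].
    by move=> xk; rewrite z0 // xk !eqxx.
  by move=> xk; rewrite !gt_eqF // z_gt0.
have := congr1 (fun M : 'rV_ _ => M 0 (lshift #|K| (enum_rank c))) zB.
rewrite mul_mx_row row_mxEl !mxE => zc; rewrite sumK -[RHS]zc.
by apply: eq_bigr => i _; rewrite !mxE !enum_rankK enum_valK mulrC.
Qed.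

Lemma lasserre_sherali_adams (R : realType) (G H : sgraph) (t : nat) :
  (0 < t)%N -> lasserre R t G H -> sherali_adams t G H.
Proof.
move=> t0 [y [psdy y_row y_col y_iso y_0]].
pose small (I : {set G * H}) := (#|I| <= t)%N.
have y_ge0 I : small I -> 0 <= y I.
  move=> It; have := @moment_psd_kernel _ _ _ _ unit (fun=> I) psdy.
  by move=> /(_ (fun=> It))/(psd_kernel_diag tt); rewrite setUid.
(* The diagonal of the moment matrix controls signs only up to size [t], so larger sets are reset to
   0. *)
pose x I := if small I then y I else 0.
pose C : finType := ((G + H) * {set G * H})%type.
(* Rows of the homogeneous system; sets of size [t] or more give zero rows. The normalization is
   left out and restored at the end by dividing by the value at [set0]. *)
pose A (c : C) (J : {set G * H}) : rat :=
  if (#|c.2| < t)%N then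
    match c.1 with
    | inl g => \sum_(h : H) (J == (g, h) |: c.2)%:R
    | inr h => \sum_(g : G) (J == (g, h) |: c.2)%:R
    end - (J == c.2)%:R
  else 0.
have delta (F : numFieldType) (f : {set G * H} -> F) I :
    \sum_J (J == I)%:R * f J = f I.
  rewrite (bigD1 I) //= big1 ?addr0 ?eqxx ?mul1r // => J /negPf->.
  by rewrite mul0r.
have AE (F : numFieldType) (f : {set G * H} -> F) (c : C) : (#|c.2| < t)%N ->
    \sum_J ratr (A c J) * f J =
    match c.1 with
    | inl g => \sum_(h : H) f ((g, h) |: c.2)
    | inr h => \sum_(g : G) f ((g, h) |: c.2)
    end - f c.2.
  move=> ct; rewrite -[X in _ - X]delta /A ct.
  under eq_bigr => J _ do rewrite rmorphB /= mulrBl ratr_nat.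
  rewrite sumrB; congr (_ - _); case: c.1 => v.
    under eq_bigr => J _ do rewrite rmorph_sum mulr_suml.
    rewrite exchange_big; apply: eq_bigr => w _; rewrite -[RHS]delta.
    by apply: eq_bigr => J _; rewrite /= ratr_nat.
  under eq_bigr => J _ do rewrite rmorph_sum mulr_suml.
  rewrite exchange_big; apply: eq_bigr => w _; rewrite -[RHS]delta.
  by apply: eq_bigr => J _; rewrite /= ratr_nat.
have small_add p (I : {set G * H}) : (#|I| < t)%N -> small (p |: I).
  by move=> It; rewrite /small cardsU1; case: (_ \notin _) => //=; apply: ltnW.
have small_lt (I : {set G * H}) : I \in subsets_le (G * H)%type (t - 1) -> (#|I| < t)%N.
  by rewrite inE; lia.
have x_ge0 I : 0 <= x I by rewrite /x; case: ifP => // /y_ge0.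
have Ax c : \sum_J ratr (A c J) * x J = 0.
  have [ct|ct] := boolP (#|c.2| < t)%N; last first.
    by rewrite big1 // => J _; rewrite /A (negPf ct) rmorph0 mul0r.
  rewrite AE // /x (ltnW ct : small c.2).
  have c2 : c.2 \in subsets_le (G * H)%type (2 * t - 2) by rewrite inE; lia.
  case: c.1 => v.
    under eq_bigr => w _ do rewrite small_add //.
    by rewrite y_row // subrr.
  under eq_bigr => w _ do rewrite small_add //.
  by rewrite y_col // subrr.
have [x' [x'_ge0 x'0 Ax']] := rational_nonneg_solution x_ge0 Ax.
have ratr_id (q : rat) : ratr q = q by rewrite /ratr divq_num_den.
have x'_row (I : {set G * H}) : (#|I| < t)%N -> forall g, \sum_(h : H) x' ((g, h) |: I) = x' I.
  move=> It g; apply/eqP; rewrite -subr_eq0 -(AE _ x' (inl g, I)) //=.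
  by under eq_bigr => J _ do rewrite ratr_id; rewrite Ax'.
have x'_col (I : {set G * H}) : (#|I| < t)%N -> forall h, \sum_(g : G) x' ((g, h) |: I) = x' I.
  move=> It h; apply/eqP; rewrite -subr_eq0 -(AE _ x' (inr h, I)) //=.
  by under eq_bigr => J _ do rewrite ratr_id; rewrite Ax'.
have x'_set0 : x' set0 != 0.
  by rewrite x'0 /x /small cards0 y_0 oner_eq0.
exists (fun I => x' I / x' set0); split.
- by move=> I _; rewrite divr_ge0.
- by rewrite divff.
- move=> I; rewrite inE => It nisoI.
  apply/eqP; rewrite mulf_eq0 x'0 /x /small It y_iso ?eqxx // inE; lia.
- by move=> I /small_lt It g; rewrite -mulr_suml x'_row.
- by move=> I /small_lt It h; rewrite -mulr_suml x'_col.
Qed.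

(** * Lasserre solutions preserve cliques *)

Definition clique_adj (R : realType) (V : sgraph) (t : nat) (a b : t.-tuple V) : R :=
  (pairwise (@edge V) (a ++ b))%:R.

(** This is [tr A^3] for the matrix [A] of [2t]-cliques; each term indicates whether [a ++ b ++ c]
    is a clique. *)
Definition clique_trace (R : realType) (V : sgraph) (t : nat) : R :=
  \sum_a \sum_b \sum_c
    @clique_adj R V t a b * clique_adj R b c * clique_adj R c a.

Lemma clique_adj_sym (R : realType) (V : sgraph) t (a b : t.-tuple V) :
  clique_adj R a b = clique_adj R b a.
Proof.
have e : allrel (@edge V) a b = allrel (@edge V) b a.
  by rewrite allrelC; apply: eq_allrel => u v; rewrite edge_sym.
by rewrite /clique_adj !pairwise_cat e [pairwise _ a && _]andbC.
Qed.

Lemma clique_adj_idem (R : realType) (V : sgraph) t (a b : t.-tuple V) :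
  clique_adj R a b * clique_adj R a b = clique_adj R a b.
Proof. by rewrite /clique_adj -natrM mulnb andbb. Qed.

Section LasserreClique.
Variables (R : realType) (t : nat) (G H : sgraph) (y : {set G * H} -> R).
Hypothesis t_gt0 : (0 < t)%N.
Hypothesis y_psd : psdmx (moment_mx t y).
Hypothesis y_row : forall I, I \in subsets_le (G * H)%type (2 * t - 2) ->
  forall g : G, \sum_(h : H) y ((g, h) |: I) = y I.
Hypothesis y_col : forall I, I \in subsets_le (G * H)%type (2 * t - 2) ->
  forall h : H, \sum_(g : G) y ((g, h) |: I) = y I.
Hypothesis y_iso : forall I, I \in subsets_le (G * H)%type (2 * t) ->
  ~~ partial_iso I -> y I = 0.
Hypothesis y_0 : y set0 = 1.

(* The vectors representing [p d |: J] are pairwise orthogonal, so they sum to the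
   vector representing [J]; this extends the linear constraints of the relaxation
   to sets of size [2t - 1]. *)
Lemma lasserre_marginal (D : finType) (p : D -> G * H) (J K : {set G * H}) :
  (#|J| < t)%N -> (#|K| <= t)%N ->
  (forall d d', d != d' -> y ((p d |: J) :|: (p d' |: J)) = 0) ->
  \sum_d y (p d |: J) = y J ->
  \sum_d y (p d |: (K :|: J)) = y (K :|: J).
Proof.
move=> Jt Kt orth sumJ.
pose s (k : option (option D)) : {set G * H} :=
  match k with None => K | Some None => J | Some (Some d) => p d |: J end.
(* The index [K] has weight 0 and serves only as the place where the radical condition is read
   off. *)
pose w (k : option (option D)) : R :=
  match k with None => 0 | Some None => -1 | Some (Some d) => 1 end.
have s_le k : (#|s k| <= t)%N.
  case: k => [[d|]|] //=; last exact: ltnW.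
  by rewrite cardsU1; case: (_ \notin _) => //=; exact: ltnW.
have psdS := moment_psd_kernel y_psd s_le.
have sumw (f : option (option D) -> R) :
    \sum_k f k * w k = \sum_d f (Some (Some d)) - f (Some None).
  rewrite !big_option /= mulr0 add0r mulrN mulr1 addrC; congr (_ - _).
  by apply: eq_bigr => d _; rewrite mulr1.
have w0 : \sum_k \sum_l w k * y (s k :|: s l) * w l = 0.
  rewrite (eq_bigr (fun k => (\sum_l y (s k :|: s l) * w l) * w k)) => [|k _]; last first.
    by rewrite mulr_suml; apply: eq_bigr => l _; ring.
  rewrite sumw !sumw /= setUid.
  rewrite (eq_bigr (fun d => 0 : R)) => [|d _].
    rewrite big1 // (eq_bigr (fun d => y (p d |: J))) => [|d _].
      by rewrite sumJ; ring.
    by rewrite setUCA setUid.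
  rewrite sumw /= (bigD1 d) //= setUid big1 ?addr0 => [|d' dd'].
    by rewrite -setUA setUid subrr.
  by apply: orth; rewrite eq_sym.
have := psd_kernel_isotropic None (fun k l => congr1 y (setUC (s k) (s l))) psdS w0.
rewrite sumw /= => /eqP; rewrite subr_eq0 => /eqP <-.
by apply: eq_bigr => d _; rewrite setUCA.
Qed.

Lemma split_small_set (I : {set G * H}) : (#|I| < 2 * t)%N ->
  exists J K : {set G * H}, [/\ (#|J| < t)%N, (#|K| <= t)%N & I = K :|: J].
Proof.
move=> It; exists [set p in take (t - 1) (enum I)], [set p in drop (t - 1) (enum I)].
have card_le (s : seq (G * H)) k : (size s <= k)%N -> (#|[set p in s]| <= k)%N.
  by move=> sk; rewrite cardsE; apply: leq_trans (card_size s) sk.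
split.
- have : (size (take (t - 1) (enum I)) <= t - 1)%N by rewrite size_take_min geq_minl.
  by move=> /card_le le; apply: leq_ltn_trans le _; lia.
- apply: card_le; rewrite cardE in It; rewrite size_drop.
  by move: It; move: (size _) => z; lia.
by apply/setP => p; rewrite !inE orbC -mem_cat cat_take_drop mem_enum.
Qed.

(** Two distinct images of one vertex never form a partial isomorphism, which supplies the
    orthogonality for [lasserre_marginal]. *)
Lemma lasserre_row (I : {set G * H}) g : (#|I| < 2 * t)%N -> \sum_h y ((g, h) |: I) = y I.
Proof.
move=> /split_small_set [J [K [Jt Kt ->]]].
apply: (lasserre_marginal (p := pair g)) => // [h h' hh'|]; last first.
  by apply: y_row; rewrite inE; lia.
apply: y_iso.
  rewrite inE (leq_trans (leq_of_leqif (leq_card_setU _ _))) // mul2n -addnn.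
  by apply: leq_add; rewrite cardsU1; case: (_ \notin _) => //=; apply: ltnW.
apply/negP => /forall_inP/(_ (g, h)); rewrite !inE eqxx => /(_ isT)/forall_inP.
by move=> /(_ (g, h')); rewrite !inE eqxx !orbT /= eqxx (negPf hh') => /(_ isT).
Qed.

Lemma lasserre_col (I : {set G * H}) h : (#|I| < 2 * t)%N -> \sum_g y ((g, h) |: I) = y I.
Proof.
move=> /split_small_set [J [K [Jt Kt ->]]].
apply: (lasserre_marginal (p := fun g => (g, h))) => // [g g' gg'|]; last first.
  by apply: y_col; rewrite inE; lia.
apply: y_iso.
  rewrite inE (leq_trans (leq_of_leqif (leq_card_setU _ _))) // mul2n -addnn.
  by apply: leq_add; rewrite cardsU1; case: (_ \notin _) => //=; apply: ltnW.
apply/negP => /forall_inP/(_ (g, h)); rewrite !inE eqxx => /(_ isT)/forall_inP.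
by move=> /(_ (g', h)); rewrite !inE eqxx !orbT /= eqxx (negPf gg') => /(_ isT).
Qed.

(** * Moments indexed by pairs of tuples and their marginals *)

Definition zip_set (g : seq G) (h : seq H) : {set G * H} := [set p in zip g h].

Lemma card_zip_set (g : seq G) (h : seq H) : (#|zip_set g h| <= size g)%N.
Proof.
by rewrite cardsE (leq_trans (card_size _)) // size_zip geq_minl.
Qed.

Lemma zip_set_cons a b (g : seq G) (h : seq H) : zip_set (a :: g) (b :: h) = (a, b) |: zip_set g h.
Proof. by apply/setP => p; rewrite !inE. Qed.

Lemma zip_set0 : zip_set [::] [::] = set0.
Proof. by apply/setP => p; rewrite !inE. Qed.

Lemma lasserre_rows k (g : k.-tuple G) (I : {set G * H}) : (k + #|I| <= 2 * t)%N ->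
  \sum_(h : k.-tuple H) y (zip_set g h :|: I) = y I.
Proof.
elim: k => [|k IHk] in g *.
  rewrite (big_pred1 [tuple]) => [|h]; first by rewrite [g]tuple0 zip_set0 set0U.
  by apply/esym/eqP; exact: tuple0.
rewrite addSn => kI; rewrite big_tuple_cons exchange_big /=.
rewrite -[RHS](IHk (behead_tuple g)) 1?ltnW //; apply: eq_bigr => h _.
rewrite (cons_behead_tuple g) /=.
under eq_bigr => b _ do rewrite zip_set_cons -setUA.
rewrite lasserre_row //; apply: leq_ltn_trans kI.
rewrite (leq_trans (leq_of_leqif (leq_card_setU _ _))) // leq_add2r.
by rewrite (leq_trans (card_zip_set _ _)) // size_tuple.
Qed.

Lemma lasserre_cols k (h : k.-tuple H) (I : {set G * H}) : (k + #|I| <= 2 * t)%N ->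
  \sum_(g : k.-tuple G) y (zip_set g h :|: I) = y I.
Proof.
elim: k => [|k IHk] in h *.
  rewrite (big_pred1 [tuple]) => [|g]; first by rewrite [h]tuple0 zip_set0 set0U.
  by apply/esym/eqP; exact: tuple0.
rewrite addSn => kI; rewrite big_tuple_cons exchange_big /=.
rewrite -[RHS](IHk (behead_tuple h)) 1?ltnW //; apply: eq_bigr => g _.
rewrite (cons_behead_tuple h) /=.
under eq_bigr => a _ do rewrite zip_set_cons -setUA.
rewrite lasserre_col //; apply: leq_ltn_trans kI.
rewrite (leq_trans (leq_of_leqif (leq_card_setU _ _))) // leq_add2r.
by rewrite (leq_trans (card_zip_set _ _)) // size_tuple.
Qed.

Local Notation T := (t.-tuple G).
Local Notation U := (t.-tuple H).

Definition pair_moment (k l : T * U) : R :=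
  y (zip_set k.1 k.2 :|: zip_set l.1 l.2).

Lemma pair_moment_sym k l : pair_moment k l = pair_moment l k.
Proof. by rewrite /pair_moment setUC. Qed.

Lemma pair_moment_row (a b : T) : \sum_h \sum_q pair_moment (a, h) (b, q) = 1.
Proof.
have zt (g : T) (h : U) : (#|zip_set g h| <= t)%N.
  by rewrite (leq_trans (card_zip_set _ _)) // size_tuple.
rewrite exchange_big /= -y_0 -(@lasserre_rows _ b) ?cards0 ?addn0 ?leq_pmull //.
apply: eq_bigr => q _; rewrite setU0; apply: lasserre_rows.
by rewrite mul2n -addnn leq_add2l zt.
Qed.

Lemma pair_moment_col (h q : U) : \sum_a \sum_b pair_moment (a, h) (b, q) = 1.
Proof.
have zt (g : T) (h' : U) : (#|zip_set g h'| <= t)%N.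
  by rewrite (leq_trans (card_zip_set _ _)) // size_tuple.
rewrite exchange_big /= -y_0 -(@lasserre_cols _ q) ?cards0 ?addn0 ?leq_pmull //.
apply: eq_bigr => b _; rewrite setU0; apply: lasserre_cols.
by rewrite mul2n -addnn leq_add2l zt.
Qed.

Lemma pair_moment_iso k l : pair_moment k l != 0 ->
  partial_iso (zip_set k.1 k.2 :|: zip_set l.1 l.2).
Proof.
apply: contraNT => niso; apply/eqP/y_iso => //.
rewrite inE (leq_trans (leq_of_leqif (leq_card_setU _ _))) // mul2n -addnn.
by apply: leq_add; rewrite (leq_trans (card_zip_set _ _)) // size_tuple.
Qed.

Lemma partial_iso_pairwise (I : {set G * H}) (g : seq G) (h : seq H) :
  partial_iso I -> size g = size h -> {subset zip g h <= I} ->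
  pairwise (@edge G) g = pairwise (@edge H) h.
Proof.
move=> isoI; elim: g h => [|a g IHg] [|b h] //= [gh] sub.
rewrite (IHg h) => [||p pgh]; [|by []|by apply: sub; rewrite inE pgh orbT].
congr (_ && _).
have abI : (a, b) \in I by apply: sub; rewrite mem_head.
have {sub}: {subset zip g h <= I} by move=> p pgh; apply: sub; rewrite inE pgh orbT.
elim: g h gh {IHg} => [|c g IHg] [|d h] //= [gh] sub.
rewrite (IHg h) => [||p pgh]; [|by []|by apply: sub; rewrite inE pgh orbT].
congr (_ && _).
have cdI : (c, d) \in I by apply: sub; rewrite mem_head.
by have /forall_inP/(_ _ abI)/forall_inP/(_ _ cdI)/andP[_ /eqP] := isoI.
Qed.

(** Nonzero moments sit on partial isomorphisms, which preserve cliques; this moves an adjacency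
    factor from one graph to the other. *)
Lemma adj_pair_moment (a b : T) (h q : U) :
  clique_adj R a b * pair_moment (a, h) (b, q) =
  clique_adj R h q * pair_moment (a, h) (b, q).
Proof.
have [->|/pair_moment_iso iso] := eqVneq (pair_moment (a, h) (b, q)) 0.
  by rewrite !mulr0.
congr (_%:R * _); congr nat_of_bool; apply: (partial_iso_pairwise iso).
  by rewrite !size_cat !size_tuple.
by move=> p; rewrite zip_cat ?size_tuple // mem_cat !inE.
Qed.

Lemma pair_moment_offdiag_row (a b : T) (h : U) : a != b -> pair_moment (a, h) (b, h) = 0.
Proof.
move=> ab; apply/eqP; apply: contraNT ab => /pair_moment_iso iso.
apply/eqP/eq_from_tnth => i.
have /forall_inP/(_ (tnth a i, tnth h i)) := iso.
have mem (c : T) : (tnth c i, tnth h i) \in zip_set c h.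
  rewrite inE; apply/(nthP (tnth a i, tnth h i)); exists i.
    by rewrite size_zip !size_tuple minnn.
  by rewrite nth_zip ?size_tuple // -!tnth_nth.
rewrite inE mem => /(_ isT)/forall_inP/(_ (tnth b i, tnth h i)).
by rewrite inE mem orbT eqxx => /(_ isT)/andP[/eqP/eqP].
Qed.

Lemma pair_moment_offdiag_col (a : T) (h q : U) : h != q -> pair_moment (a, h) (a, q) = 0.
Proof.
move=> hq; apply/eqP; apply: contraNT hq => /pair_moment_iso iso.
apply/eqP/eq_from_tnth => i.
have /forall_inP/(_ (tnth a i, tnth h i)) := iso.
have mem (c : U) : (tnth a i, tnth c i) \in zip_set a c.
  rewrite inE; apply/(nthP (tnth a i, tnth h i)); exists i.
    by rewrite size_zip !size_tuple minnn.
  by rewrite nth_zip ?size_tuple // -!tnth_nth.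
rewrite inE mem => /(_ isT)/forall_inP/(_ (tnth a i, tnth q i)).
by rewrite inE mem orbT eqxx => /(_ isT)/andP[/eqP/esym/eqP].
Qed.

(* The quadratic form of the moment matrix at the difference of the two sides,
   summed over all [a] and [h], is [tr A_G^2 - 2 tr A_G^2 + tr A_H^2 = 0]. *)
Lemma adj_intertwine (a : T) (h : U) k :
  \sum_b clique_adj R a b * pair_moment k (b, h) =
  \sum_q clique_adj R h q * pair_moment k (a, q).
Proof.
(* The difference of two vectors: one runs over clique neighbors of [a] in [G] with [h] fixed, the
   other over clique neighbors of [h] in [H] with [a] fixed. *)
pose w (a : T) (h : U) (l : T * U) : R :=
  clique_adj R a l.1 * (l.2 == h)%:R - clique_adj R h l.2 * (l.1 == a)%:R.
have sumw a' h' (f : T * U -> R) : \sum_l f l * w a' h' l =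
    \sum_b clique_adj R a' b * f (b, h') - \sum_q clique_adj R h' q * f (a', q).
  transitivity (\sum_b \sum_q f (b, q) * w a' h' (b, q)).
    by rewrite pair_bigA; apply: eq_bigr => -[].
  transitivity (\sum_b \sum_q (q == h')%:R * (clique_adj R a' b * f (b, q)) -
     \sum_q \sum_b (b == a')%:R * (clique_adj R h' q * f (b, q))).
    rewrite [X in _ - X]exchange_big -sumrB; apply: eq_bigr => b _.
    rewrite -sumrB; apply: eq_bigr => q _; rewrite /w /=.
    move: (f _) (clique_adj _ _ _) (clique_adj _ _ _) (_%:R) (_%:R) => *; ring.
  congr (_ - _); apply: eq_bigr => c _.
    rewrite (bigD1 h') //= big1 ?addr0 ?eqxx ?mul1r // => q /negPf->.
    by rewrite mul0r.
  rewrite (bigD1 a') //= big1 ?addr0 ?eqxx ?mul1r // => q /negPf->.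
  by rewrite mul0r.
have psdM : psd_kernel pair_moment.
  apply: (@moment_psd_kernel R _ t y _ (fun k : T * U => zip_set k.1 k.2) y_psd) => l.
  by rewrite (leq_trans (card_zip_set _ _)) // size_tuple.
pose Q a h := \sum_k \sum_l w a h k * pair_moment k l * w a h l.
have Q_ge0 a' h' : 0 <= Q a' h' by apply: psdM.
have QE a' h' : Q a' h' =
    \sum_b clique_adj R a' b * pair_moment (b, h') (b, h')
    - (\sum_b \sum_q clique_adj R a' b * pair_moment (a', q) (b, h') * clique_adj R h' q) *+ 2
    + \sum_q clique_adj R h' q * pair_moment (a', q) (a', q).
  rewrite /Q (eq_bigr (fun k => (\sum_l pair_moment k l * w a' h' l) * w a' h' k)); last first.
    by move=> k' _; rewrite mulr_suml; apply: eq_bigr => l _; ring.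
  rewrite sumw.
  rewrite (eq_bigr (fun b => clique_adj R a' b * pair_moment (b, h') (b, h')
     - \sum_q clique_adj R a' b * pair_moment (a', q) (b, h') * clique_adj R h' q)).
    rewrite sumrB [X in _ - X](eq_bigr (fun q =>
      (\sum_b clique_adj R a' b * pair_moment (a', q) (b, h') * clique_adj R h' q)
      - clique_adj R h' q * pair_moment (a', q) (a', q))).
      by rewrite sumrB [in X in _ - X]exchange_big /=; ring.
    move=> q _; rewrite sumw mulrBr mulr_sumr; congr (_ - _).
      by apply: eq_bigr => b _; ring.
    rewrite (bigD1 q) //= big1 ?addr0 ?mulrA ?clique_adj_idem // => q' qq'.
    by rewrite pair_moment_offdiag_col 1?eq_sym // mulr0.
  move=> b _; rewrite sumw mulrBr mulr_sumr; congr (_ - _).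
    rewrite (bigD1 b) //= big1 ?addr0 ?mulrA ?clique_adj_idem // => b' bb'.
    by rewrite pair_moment_offdiag_row 1?eq_sym // !mulr0.
  by rewrite mulr_sumr; apply: eq_bigr => q _; rewrite (pair_moment_sym (b, h')); ring.
pose SG : R := \sum_(a : T) \sum_(b : T) clique_adj R a b.
pose SH : R := \sum_(h : U) \sum_(q : U) clique_adj R h q.
(* [X] collects the cross terms. Adjacency factors move between [G] and [H] inside a moment, so [X]
   equals both [SG] and [SH]. *)
pose X : R := \sum_a' \sum_h' \sum_b \sum_q
  clique_adj R a' b * pair_moment (a', q) (b, h') * clique_adj R h' q.
have XG : X = SG.
  apply: eq_bigr => a' _; rewrite exchange_big; apply: eq_bigr => b _ /=.
  rewrite exchange_big -[RHS]mulr1 -(pair_moment_row a' b) mulr_sumr /=.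
  apply: eq_bigr => q _; rewrite mulr_sumr; apply: eq_bigr => h' _.
  rewrite -mulrA [pair_moment _ _ * _]mulrC (clique_adj_sym R h').
  by rewrite -adj_pair_moment mulrA clique_adj_idem.
have XH : X = SH.
  rewrite /X exchange_big; apply: eq_bigr => h' _ /=.
  under eq_bigr => a' _ do rewrite exchange_big.
  rewrite exchange_big; apply: eq_bigr => q _ /=.
  rewrite -[RHS]mulr1 -(pair_moment_col q h') mulr_sumr /=.
  apply: eq_bigr => a' _; rewrite mulr_sumr; apply: eq_bigr => b _.
  by rewrite adj_pair_moment (clique_adj_sym R q) mulrAC clique_adj_idem.
have diagG (b : T) : \sum_h' pair_moment (b, h') (b, h') = 1.
  rewrite -y_0 -(@lasserre_rows _ b) ?cards0 ?addn0 ?leq_pmull //.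
  by apply: eq_bigr => q _; rewrite /pair_moment setUid setU0.
have diagH (q : U) : \sum_a' pair_moment (a', q) (a', q) = 1.
  rewrite -y_0 -(@lasserre_cols _ q) ?cards0 ?addn0 ?leq_pmull //.
  by apply: eq_bigr => b _; rewrite /pair_moment setUid setU0.
have sumQ : \sum_a' \sum_h' Q a' h' = 0.
  under eq_bigr => a' _ do under eq_bigr => h' _ do rewrite QE.
  under eq_bigr => a' _ do rewrite big_split sumrB /= sumrMnl.
  rewrite big_split sumrB /= sumrMnl -/X.
  rewrite (_ : \sum_a' \sum_h' \sum_b _ = SG); last first.
    apply: eq_bigr => a' _; rewrite exchange_big; apply: eq_bigr => b _ /=.
    by rewrite -mulr_sumr diagG mulr1.
  rewrite (_ : \sum_a' \sum_h' \sum_q _ = SH); last first.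
    rewrite exchange_big; apply: eq_bigr => h' _; rewrite exchange_big.
    by apply: eq_bigr => q _ /=; rewrite -mulr_sumr diagH mulr1.
  by rewrite -{1}XG -XH; ring.
have Qah : Q a h = 0.
  have /eqP := sumQ; rewrite psumr_eq0 => [/allP/(_ a (mem_index_enum _))|a' _]; last first.
    by apply: sumr_ge0 => h' _; apply: Q_ge0.
  rewrite /= psumr_eq0 => [/allP/(_ h (mem_index_enum _))/eqP//|h' _].
  exact: Q_ge0.
have := psd_kernel_isotropic k pair_moment_sym psdM Qah.
by rewrite sumw => /eqP; rewrite subr_eq0 => /eqP.
Qed.

(** The three adjacency factors move from [G] to [H] one at a time: the first and the last inside a
    single moment, the middle one by [adj_intertwine]. Total moment 1 is inserted at the start and
    summed out at the end. *)
Lemma clique_trace_eq : clique_trace R G t = clique_trace R H t.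
Proof.
transitivity (\sum_(a : T) \sum_(b : T) \sum_(c : T) \sum_(h : U) \sum_(q : U)
   clique_adj R c a * clique_adj R h q * (clique_adj R a b * pair_moment (c, q) (b, h))).
  apply: eq_bigr => a _; apply: eq_bigr => b _; apply: eq_bigr => c _.
  rewrite -[LHS]mulr1 -(pair_moment_row b c) mulr_sumr; apply: eq_bigr => h _.
  rewrite mulr_sumr; apply: eq_bigr => q _; rewrite (pair_moment_sym (c, q)).
  transitivity (clique_adj R a b * clique_adj R c a *
    (clique_adj R b c * pair_moment (b, h) (c, q))); first by ring.
  by rewrite adj_pair_moment; ring.
transitivity (\sum_(a : T) \sum_(c : T) \sum_(h : U) \sum_(q : U) \sum_(h' : U)
   clique_adj R c a * clique_adj R h q * (clique_adj R h h' * pair_moment (c, q) (a, h'))).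
  apply: eq_bigr => a _; rewrite exchange_big; apply: eq_bigr => c _ /=.
  rewrite exchange_big; apply: eq_bigr => h _ /=.
  rewrite exchange_big; apply: eq_bigr => q _ /=.
  by rewrite -!mulr_sumr adj_intertwine.
under eq_bigr => a _ do rewrite exchange_big.
rewrite exchange_big; apply: eq_bigr => h _ /=.
under eq_bigr => a _ do under eq_bigr => c _ do rewrite exchange_big.
under eq_bigr => a _ do rewrite exchange_big.
rewrite exchange_big; apply: eq_bigr => h' _ /=.
under eq_bigr => a _ do rewrite exchange_big.
rewrite exchange_big; apply: eq_bigr => q _ /=.
rewrite exchange_big -[RHS]mulr1 -(pair_moment_col q h') mulr_sumr /=.
apply: eq_bigr => c _; rewrite mulr_sumr; apply: eq_bigr => a _.
rewrite [LHS](_ : _ = clique_adj R h q * clique_adj R h h' *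
  (clique_adj R c a * pair_moment (c, q) (a, h'))); last by ring.
by rewrite adj_pair_moment (clique_adj_sym R h q) (clique_adj_sym R q h'); ring.
Qed.

End LasserreClique.

Lemma clique_trace_neq0 (R : realType) (V : sgraph) (t : nat) :
  clique_trace R V t != 0 <-> exists2 s : seq V, size s = (3 * t)%N & pairwise (@edge V) s.
Proof.
have adjE (a b c : t.-tuple V) :
    clique_adj R a b * clique_adj R b c * clique_adj R c a =
    (pairwise (@edge V) (a ++ b ++ c))%:R.
  rewrite (clique_adj_sym R c a) /clique_adj -!natrM !mulnb !pairwise_cat !allrel_catr.
  by congr (nat_of_bool _)%:R; do 3!case: (allrel _ _ _); do 3!case: (pairwise _ _).
have ge0 (a b c : t.-tuple V) :
    0 <= clique_adj R a b * clique_adj R b c * clique_adj R c a.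
  by rewrite adjE ler0n.
split=> [|[s sz cl]].
  move=> tr0; have [abc cl|none] := pickP (fun p : t.-tuple V * t.-tuple V * t.-tuple V =>
      pairwise (@edge V) (p.1.1 ++ p.1.2 ++ p.2)).
    by exists (abc.1.1 ++ abc.1.2 ++ abc.2) => //; rewrite !size_cat !size_tuple; lia.
  case/eqP: tr0; do 3!(apply: big1 => ? _); rewrite adjE.
  by rewrite (none (_, _, _)).
have sz1 : size (take t s) = t by rewrite size_take sz; case: ifP; lia.
have sz2 : size (take t (drop t s)) = t.
  by rewrite size_take size_drop sz; case: ifP; lia.
have sz3 : size (drop t (drop t s)) = t by rewrite !size_drop sz; lia.
pose a := Tuple (introT eqP sz1); pose b := Tuple (introT eqP sz2).
pose c := Tuple (introT eqP sz3).
rewrite gt_eqF //.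
rewrite /clique_trace (bigD1 a) //= ltr_pwDl; last 2 first.
- rewrite (bigD1 b) //= ltr_pwDl; last 2 first.
  + rewrite (bigD1 c) //= ltr_pwDl ?sumr_ge0 //.
    by rewrite adjE /= !cat_take_drop cl ltr01.
  + by apply: sumr_ge0 => ? _; apply: sumr_ge0.
  + by [].
- by apply: sumr_ge0 => ? _; apply: sumr_ge0 => ? _; apply: sumr_ge0.
by [].
Qed.

Lemma lasserre_clique (R : realType) (G H : sgraph) (t : nat) :
  (0 < t)%N -> lasserre R t G H ->
  (exists2 s : seq G, size s = (3 * t)%N & pairwise (@edge G) s) ->
  exists2 s : seq H, size s = (3 * t)%N & pairwise (@edge H) s.
Proof.
move=> t0 [y [psdy y_row y_col y_iso y_0]] /(clique_trace_neq0 R) G0.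
apply/(clique_trace_neq0 R).
by rewrite -(clique_trace_eq t0 psdy y_row y_col y_iso y_0).
Qed.

(** * Cai-Fuerer-Immerman graphs of complete graphs *)

Definition parity (n : nat) (f : {ffun 'I_n -> bool}) : bool :=
  \big[addb/false]_u f u.

Lemma parity_add n (f g : {ffun 'I_n -> bool}) :
  parity [ffun u => f u (+) g u] = parity f (+) parity g.
Proof.
by rewrite /parity -big_split; apply: eq_bigr => u _; rewrite ffunE.
Qed.

(** One coordinate outside [B] is forced by the parity and the others are free. The induction moves
    a free coordinate into [B] with each of its two values. *)
Lemma card_parity_extension n (B : {set 'I_n}) (c : 'I_n -> bool) (p : bool) :
  (#|B| < n)%N ->
  #|[set d : {ffun 'I_n -> bool} | [forall u in B, d u == c u] && (parity d == p)]|
  = (2 ^ (n - #|B|.+1))%N.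
Proof.
move=> Bn; move: {1 3}(n - #|B|.+1)%N (erefl (n - #|B|.+1)%N) => k.
have max_n (A : {set 'I_n}) : (#|A| <= n)%N by have := max_card (mem A); rewrite card_ord.
elim: k B c Bn => [|k IHk] B c Bn nk.
  have /cards1P [v Bv] : #|~: B| == 1%N.
    by rewrite cardsCs setCK card_ord; apply/eqP; lia.
  have inB u : (u \in B) = (u != v).
    have : (u \in ~: B) = (u == v) by rewrite Bv inE.
    by rewrite inE => <-; rewrite negbK.
  pose d0 : {ffun 'I_n -> bool} :=
    [ffun u => if u == v then p (+) \big[addb/false]_(u | u != v) c u else c u].
  rewrite expn0; apply/eqP/cards1P; exists d0; apply/setP => d; rewrite !inE.
  apply/andP/eqP => [[/forall_inP dB /eqP dp]|->].
    have dE u : u != v -> d u = c u by rewrite -inB => /dB/eqP.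
    apply/ffunP => u; rewrite ffunE; case: (eqVneq u v) => [->|/dE//].
    rewrite -dp /parity (bigD1 v) //= (eq_bigr c) => [|w /dE//].
    by rewrite -addbA addbb addbF.
  split.
    by apply/forall_inP => u; rewrite inB ffunE => /negPf->.
  rewrite /parity (bigD1 v) //= ffunE eqxx (eq_bigr c) => [|w /negPf wv].
    by rewrite -addbA addbb addbF.
  by rewrite ffunE wv.
have /card_gt0P [v] : (0 < #|~: B|)%N by rewrite cardsCs setCK card_ord; lia.
rewrite inE => vB.
pose cc (b : bool) u := if u == v then b else c u.
pose D b := [set d : {ffun 'I_n -> bool} |
  [forall u in v |: B, d u == cc b u] && (parity d == p)].
have Dcard b : #|D b| = (2 ^ k)%N.
  by apply: IHk; rewrite cardsU1 vB; lia.
have DE b d : (d \in D b) = [&& [forall u in B, d u == c u], parity d == p & d v == b].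
  rewrite inE [RHS]andbA andbAC; congr (_ && _); apply/forall_inP/andP.
    move=> dB; split; last by have := dB v (setU11 _ _); rewrite /cc eqxx.
    apply/forall_inP => u uB; have := dB u (setU1r _ uB); rewrite /cc.
    by case: (u =P v) => // uv; rewrite -uv uB in vB.
  case=> /forall_inP dB dv u; rewrite in_setU1 /cc.
  by case: (u =P v) => [->|_ /dB].
rewrite (_ : [set _ | _] = D true :|: D false).
  rewrite cardsU !Dcard (_ : D true :&: D false = set0).
    by rewrite cards0 subn0 addnn -mul2n expnS.
  by apply/setP => d; rewrite inE !DE inE; case: (d v); rewrite ?andbF.
apply/setP => d; rewrite [RHS]inE !DE inE.
by case: (d v); rewrite ?andbT ?andbF ?orbF.
Qed.

Section Cfi.
Variable n : nat.

(** A vertex over the base vertex [v] assigns a bit to each base edge at [v], with parity [tau v].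
    The bit at [v] itself belongs to no edge and is set to false. *)
Definition cfi_vertex_pred (tau : 'I_n -> bool) (p : 'I_n * {ffun 'I_n -> bool}) :=
  ~~ p.2 p.1 && (parity p.2 == tau p.1).

Definition cfi_vertex (tau : 'I_n -> bool) : finType := {p | cfi_vertex_pred tau p}.

Definition cfi_base tau (x : cfi_vertex tau) : 'I_n := (val x).1.
Definition cfi_fun tau (x : cfi_vertex tau) : {ffun 'I_n -> bool} := (val x).2.

Definition cfi_edge tau : rel (cfi_vertex tau) := fun x y =>
  (cfi_base x != cfi_base y) && (cfi_fun x (cfi_base y) == cfi_fun y (cfi_base x)).

Lemma cfi_edge_sym tau : symmetric (@cfi_edge tau).
Proof.
by move=> x y; rewrite /cfi_edge eq_sym [cfi_fun x _ == _]eq_sym.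
Qed.

Lemma cfi_edge_irr tau : irreflexive (@cfi_edge tau).
Proof. by move=> x; rewrite /cfi_edge eqxx. Qed.

(* The Cai-Fuerer-Immerman graph of the complete graph on ['I_n], twisted at the
   vertices [v] with [tau v]. *)
Definition cfi tau : sgraph := SGraph (@cfi_edge_sym tau) (@cfi_edge_irr tau).

Lemma cfi_eq tau (x y : cfi tau) :
  cfi_base x = cfi_base y -> cfi_fun x = cfi_fun y -> x = y.
Proof.
move=> b f; apply: val_inj; rewrite [val x]surjective_pairing [val y]surjective_pairing.
by rewrite -/(cfi_base x) -/(cfi_fun x) b f.
Qed.

Lemma cfi_fun_base tau (x : cfi tau) : cfi_fun x (cfi_base x) = false.
Proof. by have /andP[/negPf] := valP x. Qed.

Lemma cfi_fun_parity tau (x : cfi tau) : parity (cfi_fun x) = tau (cfi_base x).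
Proof. by have /andP[_ /eqP] := valP x. Qed.

(** * The Sherali-Adams solution between two such graphs *)

Section Solution.
Variables tau tau' : 'I_n -> bool.
Local Notation G := (cfi tau).
Local Notation H := (cfi tau').

Definition cfi_shift (p : G * H) : {ffun 'I_n -> bool} :=
  [ffun u => cfi_fun p.1 u (+) cfi_fun p.2 u].

(** Shifts at different base vertices must agree on the common base edge; at one base vertex there
    is only one shift. *)
Definition cfi_compat (p q : G * H) : bool :=
  (cfi_shift p (cfi_base q.1) == cfi_shift q (cfi_base p.1)) &&
  ((cfi_base p.1 == cfi_base q.1) ==> (cfi_shift p == cfi_shift q)).

Definition cfi_consistent (I : {set G * H}) : bool :=
  [forall p in I, (cfi_base p.1 == cfi_base p.2) && [forall q in I, cfi_compat p q]].

Definition cfi_bases (I : {set G * H}) : {set 'I_n} := [set cfi_base p.1 | p in I].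

(* The probability that a uniformly random local shift on [k] base vertices takes
   a prescribed value. *)
Definition cfi_weight (k : nat) : rat := \prod_(i < k) (2 ^+ (n - 2 - i))^-1.

Definition cfi_solution (I : {set G * H}) : rat :=
  if cfi_consistent I then cfi_weight #|cfi_bases I| else 0.

Lemma cfi_compat_sym p q : cfi_compat p q = cfi_compat q p.
Proof.
by rewrite /cfi_compat eq_sym [cfi_base _ == _]eq_sym [cfi_shift _ == cfi_shift q]eq_sym.
Qed.

Lemma cfi_compat_refl p : cfi_compat p p.
Proof. by rewrite /cfi_compat !eqxx implybT. Qed.

Lemma cfi_consistentU1 p (I : {set G * H}) : cfi_consistent (p |: I) =
  [&& cfi_base p.1 == cfi_base p.2, [forall q in I, cfi_compat p q] & cfi_consistent I].
Proof.
apply/forall_inP/and3P => [c|[bp /forall_inP cp /forall_inP c] q].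
  have /andP[bp /forall_inP cp] := c p (setU11 _ _); split=> //.
    by apply/forall_inP => q qI; apply: cp; apply: setU1r.
  apply/forall_inP => q qI; have /andP[-> /forall_inP cq] := c q (setU1r _ qI).
  by apply/forall_inP => r rI; apply: cq; apply: setU1r.
rewrite in_setU1 => /predU1P[->|qI].
  rewrite bp; apply/forall_inP => r; rewrite in_setU1 => /predU1P[->|/cp//].
  exact: cfi_compat_refl.
have /andP[-> /forall_inP cq] := c q qI.
apply/forall_inP => r; rewrite in_setU1 => /predU1P[->|/cq//].
by rewrite cfi_compat_sym cp.
Qed.

Lemma cfi_bases_U1 p (I : {set G * H}) : cfi_bases (p |: I) = cfi_base p.1 |: cfi_bases I.
Proof. by rewrite /cfi_bases imsetU1. Qed.

Lemma cfi_weightS k : cfi_weight k.+1 = cfi_weight k * (2 ^+ (n - 2 - k))^-1.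
Proof. by rewrite /cfi_weight big_ord_recr. Qed.

Lemma cfi_weight_ge0 k : 0 <= cfi_weight k.
Proof. by apply: prodr_ge0 => i _; rewrite invr_ge0 exprn_ge0. Qed.

Lemma cfi_shift_base p : cfi_base p.1 = cfi_base p.2 -> cfi_shift p (cfi_base p.1) = false.
Proof. by move=> e; rewrite ffunE cfi_fun_base e cfi_fun_base. Qed.

Lemma cfi_shift_parity p : cfi_base p.1 = cfi_base p.2 ->
  parity (cfi_shift p) = tau (cfi_base p.1) (+) tau' (cfi_base p.1).
Proof. by move=> e; rewrite parity_add !cfi_fun_parity e. Qed.

Lemma cfi_shift_inv (g : G) (d : {ffun 'I_n -> bool}) :
  d (cfi_base g) = false ->
  parity d = tau (cfi_base g) (+) tau' (cfi_base g) ->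
  exists h : H, cfi_base h = cfi_base g /\ cfi_shift (g, h) = d.
Proof.
move=> d0 dp; pose f : {ffun 'I_n -> bool} := [ffun u => cfi_fun g u (+) d u].
have fP : cfi_vertex_pred tau' (cfi_base g, f).
  rewrite /cfi_vertex_pred /= ffunE cfi_fun_base d0 /= parity_add cfi_fun_parity dp.
  by rewrite addbA addbb.
exists (Sub (cfi_base g, f) fP); split; first by rewrite /cfi_base SubK.
by apply/ffunP => u; rewrite ffunE /= /cfi_fun SubK /= ffunE addbA addbb.
Qed.

Lemma cfi_shift_inj (g : G) (h h' : H) : cfi_base h = cfi_base h' ->
  cfi_shift (g, h) = cfi_shift (g, h') -> h = h'.
Proof.
move=> b /ffunP s; apply: cfi_eq => //; apply/ffunP => u.
by have := s u; rewrite !ffunE => /addbI.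
Qed.

Definition cfi_extensions (I : {set G * H}) (g : G) : {set H} :=
  [set h | (cfi_base g == cfi_base h) && [forall q in I, cfi_compat (g, h) q]].

Lemma card_cfi_extensions_in I g : cfi_consistent I -> cfi_base g \in cfi_bases I ->
  #|cfi_extensions I g| = 1%N.
Proof.
move=> /forall_inP c /imsetP [p pI gp].
have /andP[/eqP bp /forall_inP cp] := c p pI.
have [h [bh sh]] : exists h : H, cfi_base h = cfi_base g /\ cfi_shift (g, h) = cfi_shift p.
  by apply: cfi_shift_inv; rewrite gp ?cfi_shift_base ?cfi_shift_parity.
apply/eqP/cards1P; exists h; apply/setP => h'; rewrite !inE.
apply/andP/eqP => [[/eqP bh' /forall_inP ch']|->].
  apply: (@cfi_shift_inj g); first by rewrite -bh' bh.
  have /andP[_] := ch' p pI; rewrite /= gp eqxx /= => /eqP ->.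
  by rewrite sh.
rewrite bh eqxx; split=> //; apply/forall_inP => q qI.
by have := cp q qI; rewrite /cfi_compat sh /= gp.
Qed.

(** Of the [n] bits of the shift, the one at the base of [g] and those towards the bases in use are
    prescribed, and one more is fixed by the parity. *)
Lemma card_cfi_extensions_notin I g : (#|cfi_bases I| + 2 <= n)%N ->
  cfi_consistent I -> cfi_base g \notin cfi_bases I ->
  #|cfi_extensions I g| = (2 ^ (n - 2 - #|cfi_bases I|))%N.
Proof.
move=> In /forall_inP c gI.
(* The bit prescribed by some pair of [I] over [u]; by consistency any such pair gives the same
   bit. *)
pose val u := if [pick q in I | cfi_base q.1 == u] is Some q
  then cfi_shift q (cfi_base g) else false.
have valI q : q \in I -> val (cfi_base q.1) = cfi_shift q (cfi_base g).
  move=> qI; rewrite /val; case: pickP => [r /andP[rI rq]|/(_ q)]; last by rewrite qI eqxx.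
  have /andP[_ /forall_inP/(_ q qI)/andP[_]] := c r rI.
  by rewrite rq /= => /eqP ->.
have valg : val (cfi_base g) = false.
  rewrite /val; case: pickP => // r /andP[rI /eqP rg].
  by case/negP: gI; rewrite -rg; apply: imset_f.
have Bn : (#|cfi_base g |: cfi_bases I| < n)%N by rewrite cardsU1 gI add1n; rewrite addn2 in In.
have := card_parity_extension val (tau (cfi_base g) (+) tau' (cfi_base g)) Bn.
rewrite cardsU1 gI add1n -subnDA add2n.
move<-; rewrite -(@card_in_imset _ _ (fun h => cfi_shift (g, h))); last first.
  move=> h h'; rewrite !inE => /andP[/eqP bh _] /andP[/eqP bh' _].
  by apply: cfi_shift_inj; rewrite -bh.
congr #|pred_of_set _|; apply/setP => d; rewrite inE; apply/imsetP/andP.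
  case=> h; rewrite inE => /andP[/eqP bh /forall_inP ch] ->; split.
    apply/forall_inP => u; rewrite in_setU1 => /predU1P[->|/imsetP[q qI ->]].
      by rewrite valg cfi_shift_base.
    by rewrite valI //; have /andP[] := ch q qI.
  by rewrite cfi_shift_parity.
case=> /forall_inP dB /eqP dp.
have [|h [bh sh]] := @cfi_shift_inv g d _ dp.
  by have /eqP := dB (cfi_base g) (setU11 _ _); rewrite valg.
exists h => //; rewrite inE bh eqxx; apply/forall_inP => q qI.
rewrite /cfi_compat sh /= -valI //.
have qB : cfi_base q.1 \in cfi_bases I by apply: imset_f.
rewrite dB ?setU1r //=; case: eqP => // gq.
by rewrite -gq (negPf gI) in qB.
Qed.

(** All consistent extensions have the same weight, and over a new base their number cancels the
    factor gained by [cfi_weight]; over an old base the extension is unique. *)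
Lemma cfi_solution_row (I : {set G * H}) g : (#|I| + 2 <= n)%N ->
  \sum_(h : H) cfi_solution ((g, h) |: I) = cfi_solution I.
Proof.
move=> In; rewrite /cfi_solution; have [cI|ncI] := boolP (cfi_consistent I); last first.
  by rewrite big1 // => h _; rewrite cfi_consistentU1 (negPf ncI) !andbF.
under eq_bigr => h _ do rewrite cfi_consistentU1 cI andbT cfi_bases_U1 /=.
rewrite -big_mkcond (eq_bigl (mem (cfi_extensions I g))) => [|h]; last by rewrite !inE.
rewrite sumr_const.
have [gI|gI] := boolP (cfi_base g \in cfi_bases I).
  rewrite card_cfi_extensions_in // mulr1n.
  by rewrite (setUidPr _) // sub1set.
have BI : (#|cfi_bases I| + 2 <= n)%N.
  by apply: leq_trans In; rewrite leq_add2r leq_imset_card.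
rewrite card_cfi_extensions_notin // cardsU1 gI add1n cfi_weightS -[_ *+ (2 ^ _)]mulr_natr.
by rewrite natrX -mulrA mulVf ?mulr1 // expf_neq0.
Qed.

(** Adding the same bit at both ends of a base edge preserves agreement on it, and one shift per
    base vertex makes the map well defined and injective. *)
Lemma cfi_consistent_iso I : cfi_consistent I -> partial_iso I.
Proof.
move=> /forall_inP c; apply/forall_inP => p pI; apply/forall_inP => q qI.
have /andP[/eqP bp /forall_inP/(_ q qI)/andP[/eqP s1 s2]] := c p pI.
have /andP[/eqP bq _] := c q qI.
apply/andP; split; apply/eqP; last first.
  rewrite /= /cfi_edge -bp -bq; congr (_ && _).
  move: s1; rewrite !ffunE.
  by do 4!case: (cfi_fun _ _).
apply/eqP/eqP => e.
  apply: cfi_eq; first by rewrite -bp -bq e.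
  move: s2; rewrite e eqxx => /eqP/ffunP s2; apply/ffunP => u.
  by have := s2 u; rewrite !ffunE e => /addbI.
have b1 : cfi_base p.1 = cfi_base q.1 by rewrite bp bq e.
apply: cfi_eq => //; move: s2; rewrite b1 eqxx => /eqP/ffunP s2; apply/ffunP => u.
by have := s2 u; rewrite !ffunE e => /addIb.
Qed.

End Solution.

Section Swap.
Variables tau tau' : 'I_n -> bool.
Local Notation swap := (fun p => (p.2, p.1)).

Lemma cfi_swap_consistent (I : {set cfi tau * cfi tau'}) :
  cfi_consistent I -> cfi_consistent [set swap p | p in I].
Proof.
move=> /forall_inP c; apply/forall_inP => _ /imsetP [p pI ->] /=.
have /andP[bp /forall_inP cp] := c p pI.
rewrite eq_sym bp; apply/forall_inP => _ /imsetP [q qI ->].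
have /andP[/eqP bq _] := c q qI.
have shiftE (r : cfi tau * cfi tau') : cfi_shift (swap r) = cfi_shift r.
  by apply/ffunP => u; rewrite !ffunE addbC.
have := cp q qI; rewrite /cfi_compat !shiftE /= bq.
by rewrite (eqP bp).
Qed.

Lemma cfi_bases_swap (I : {set cfi tau * cfi tau'}) : cfi_consistent I ->
  cfi_bases [set swap p | p in I] = cfi_bases I.
Proof.
move=> /forall_inP c; rewrite /cfi_bases -imset_comp; apply: eq_in_imset => p pI /=.
by have /andP[/eqP -> _] := c p pI.
Qed.
End Swap.

(** Bases are read off the first components, and consistency makes both components agree. Exchanging
    the graphs thus turns row sums into column sums. *)
Lemma cfi_solution_swap tau tau' (I : {set cfi tau * cfi tau'}) :
  cfi_solution [set (p.2, p.1) | p in I] = cfi_solution I.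
Proof.
rewrite /cfi_solution; case: ifP => [cs|ncs]; case: ifP => [cI|ncI] //.
- by rewrite cfi_bases_swap.
- have := cfi_swap_consistent cs; rewrite -imset_comp (_ : _ @: I = I) ?ncI //.
  by rewrite -[RHS]imset_id; apply: eq_imset => -[].
by rewrite cfi_swap_consistent in ncs.
Qed.

Lemma cfi_solution_col tau tau' (I : {set cfi tau * cfi tau'}) h : (#|I| + 2 <= n)%N ->
  \sum_(g : cfi tau) cfi_solution ((g, h) |: I) = cfi_solution I.
Proof.
move=> In; rewrite -[RHS]cfi_solution_swap -(cfi_solution_row h); last first.
  by rewrite card_imset // => -[? ?] [? ?] [-> ->].
by apply: eq_bigr => g _; rewrite -cfi_solution_swap imsetU1.
Qed.

Lemma cfi_sherali_adams tau tau' : (1 < n)%N ->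
  sherali_adams (n - 1) (cfi tau) (cfi tau').
Proof.
move=> n1.
have le_n (I : {set cfi tau * cfi tau'}) :
    I \in subsets_le (cfi tau * cfi tau')%type (n - 1 - 1) -> (#|I| + 2 <= n)%N.
  by rewrite inE; move: #|_| => k; lia.
exists (@cfi_solution tau tau'); split.
- by move=> I _; rewrite /cfi_solution; case: ifP => // _; apply: cfi_weight_ge0.
- rewrite /cfi_solution /cfi_bases imset0 cards0 /cfi_weight big_ord0.
  by case: ifP => // /negP []; apply/forall_inP => p; rewrite inE.
- move=> I _ niso; rewrite /cfi_solution; case: ifP => // /cfi_consistent_iso.
  by rewrite (negPf niso).
- by move=> I /le_n In g; apply: cfi_solution_row.
- by move=> I /le_n In h; apply: cfi_solution_col.
Qed.

(** The vertices with all bits false, one over each base vertex, agree on every base edge. *)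
Lemma cfi_clique : exists2 s : seq (cfi (fun=> false)),
  size s = n & pairwise (@edge (cfi (fun=> false))) s.
Proof.
have zP v : cfi_vertex_pred (fun=> false) (v, [ffun=> false]).
  rewrite /cfi_vertex_pred /= ffunE /= /parity big1 // => u _.
  by rewrite ffunE.
exists [seq (Sub (v, [ffun=> false]) (zP v) : cfi_vertex (fun=> false)) | v <- enum 'I_n].
  by rewrite size_map size_enum_ord.
rewrite pairwise_map; have := enum_uniq 'I_n; rewrite uniq_pairwise.
apply: sub_pairwise => u v /= uv.
by rewrite /cfi_edge /cfi_base /cfi_fun !SubK /= uv !ffunE.
Qed.

Lemma pairwise_in_sym (T : eqType) (r : rel T) (s : seq T) :
  symmetric r -> pairwise r s -> {in s &, forall x y, x != y -> r x y}.
Proof.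
move=> rs; elim: s => [|a s IHs] //= /andP[/allP ra /IHs IH] x y.
rewrite !inE => /predU1P[->|xs] /predU1P[->|ys]; first by rewrite eqxx.
- by move=> _; apply: ra.
- by move=> _; rewrite rs; apply: ra.
exact: IH.
Qed.

(** Modulo 2 the terms at [(u, v)] and [(v, u)] cancel. *)
Lemma sum_sym_bool (f : 'I_n -> 'I_n -> bool) :
  (forall u v, f u v = f v u) -> (forall u, f u u = false) ->
  \big[addb/false]_u \big[addb/false]_v f u v = false.
Proof.
move=> fs f0.
pose a := \big[addb/false]_(u : 'I_n) \big[addb/false]_(v : 'I_n) ((u < v)%N && f u v).
suff -> : \big[addb/false]_u \big[addb/false]_v f u v = a (+) a by rewrite addbb.
rewrite /a [X in _ = _ (+) X]exchange_big -big_split.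
apply: eq_bigr => u _; rewrite -big_split; apply: eq_bigr => v _ /=.
rewrite (fs v u); case: ltngtP => [_|_|/ord_inj ->] /=; rewrite ?addbF //.
Qed.

(** Edges join distinct bases, so the clique has one vertex over each base vertex. Its bits form a
    symmetric matrix with zero diagonal, of even total, whereas row [u] has parity [tau u]. *)
Lemma cfi_no_clique tau (s : seq (cfi tau)) :
  \big[addb/false]_v tau v -> size s = n -> pairwise (@edge (cfi tau)) s -> False.
Proof.
move=> odd_tau sn cl.
have base_uniq : uniq (map (@cfi_base tau) s).
  rewrite uniq_pairwise pairwise_map; apply: sub_pairwise cl => x y.
  by case/andP.
have base_all v : v \in map (@cfi_base tau) s.
  have sub : {subset map (@cfi_base tau) s <= enum 'I_n} by move=> u _; rewrite mem_enum.
  have [|_ ->] := uniq_min_size base_uniq sub; last by rewrite mem_enum.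
  by rewrite size_enum_ord (size_map (@cfi_base tau)) sn.
have edge_s := pairwise_in_sym (@edge_sym (cfi tau)) cl.
have pick_s v : {x | (x \in s) && (cfi_base x == v)}.
  by apply: sigW; have /mapP [x xs ->] := base_all v; exists x; rewrite xs eqxx.
pose z u v := cfi_fun (sval (pick_s u)) v.
have z_sym u v : z u v = z v u.
  rewrite /z; case: (pick_s u) (pick_s v) => [x /= /andP[xs /eqP xu]] [y /= /andP[ys /eqP yv]].
  have [xy|xy] := eqVneq x y; first by rewrite -xu -yv xy.
  by have /andP[_ /eqP] := edge_s x y xs ys xy; rewrite xu yv.
have z0 u : z u u = false.
  by rewrite /z; case: (pick_s u) => x /= /andP[_ /eqP <-]; rewrite cfi_fun_base.
have := sum_sym_bool z_sym z0; rewrite (eq_bigr tau) => [|u _].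
  by rewrite odd_tau.
rewrite /z; case: (pick_s u) => x /= /andP[_ /eqP <-].
exact: cfi_fun_parity.
Qed.

End Cfi.

Lemma sherali_adams_not_lasserre (R : realType) (t : nat) : (0 < t)%N ->
  exists G H : sgraph, sherali_adams (3 * t - 1) G H /\ ~ lasserre R t G H.
Proof.
move=> t0; have n0 : (0 < 3 * t)%N by lia.
(* A single twist makes the total parity odd. *)
pose tau (v : 'I_(3 * t)) := v == Ordinal n0.
exists (cfi (fun _ : 'I_(3 * t) => false)), (cfi tau); split.
  by apply: cfi_sherali_adams; lia.
move=> /(lasserre_clique t0) /(_ (cfi_clique _)) [s sn cl].
apply: (cfi_no_clique _ sn cl); rewrite (bigD1 (Ordinal n0)) //= big1 /tau ?eqxx //.
by move=> v /negPf.
Qed.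

Theorem theorem1p1 (R : realType) :
  (forall (G H : sgraph) (t : nat), (1 <= t)%N ->
     (sherali_adams (3 * t) G H -> lasserre R t G H) /\
     (lasserre R t G H -> sherali_adams t G H)) /\
  (forall t : nat, (1 <= t)%N ->
     exists G H : sgraph,
       sherali_adams (3 * t - 1) G H /\ ~ lasserre R t G H).
Proof.
split=> [G H t t1|t t1]; last exact: sherali_adams_not_lasserre.
by split; [exact: sherali_adams_lasserre|exact: lasserre_sherali_adams].
Qed.
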